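(* For $1\le p<\infty$, the set $H_{\mathcal K_p}(\ell_1,\ell_p)\setminus\mathcal H_{\mathcal K_p}(\ell_1,\ell_p)$ is spaceable as a subset of $(\mathcal H_{\mathcal K}(\ell_1,\ell_p),\tau_\omega)$.
   Context: All Banach spaces are complex; $B_E$ is the open unit ball of $E$. A set $K\subset F$ is relatively $p$-compact ($1\le p<\infty$, $p'$ the conjugate index) if there is a sequence $(x_n)_n$ in $F$ with $\sum_n\|x_n\|^p<\infty$ and $K\subset\{\sum_n\alpha_nx_n:(\alpha_n)_n\in B_{\ell_{p'}}\}$. $\mathcal H(E,F)$ is the space of holomorphic functions $f:E\to F$, i.e. for each $x_0\in E$ there are $\varepsilon>0$ and continuous $n$-homogeneous polynomials $P_nf(x_0):E\to F$ with $f(x)=\sum_{n=0}^\infty P_nf(x_0)(x-x_0)$ uniformly on $x_0+\varepsilon B_E$ (the Taylor series of $f$ at $x_0$). $\mathcal H_{\mathcal K}(E,F)$ (compact holomorphic functions) consists of those $f\in\mathcal H(E,F)$ such that for every $x_0\in E$ there is $\varepsilon>0$ with $f(x_0+\varepsilon B_E)$ relatively compact in $F$. $\mathcal H_{\mathcal K_p}(E,F)$ ($p$-compact holomorphic functions) is defined in the same way with ''relatively $p$-compact'' in place of ''relatively compact''. $H_{\mathcal K_p}(E,F)$ is the set of $f\in\mathcal H(E,F)$ such that for every $x_0\in E$ and every $n$, the polynomial $P_nf(x_0)$ is $p$-compact, i.e. $P_nf(x_0)(B_E)$ is relatively $p$-compact. One has $\mathcal H_{\mathcal K_p}\subset H_{\mathcal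 K_p}\subset\mathcal H_{\mathcal K}$. The Nachbin topology $\tau_\omega$ on $\mathcal H(E,F)$ is generated by the seminorms $f\mapsto\sum_{n=0}^\infty\sup_{x\in K+\alpha_nB_E}\|P_nf(0)(x)\|$, where $K$ ranges over the compact balanced subsets of $E$ and $(\alpha_n)_n$ over $c_0$. A subset $A$ of a topological vector space $X$ is spaceable if $A\cup\{0\}$ contains a closed infinite-dimensional linear subspace of $X$. *)

(* Defs.v *)
From HB Require Import structures.
From mathcomp Require Import all_boot all_order all_algebra.
From mathcomp Require Import complex.
From mathcomp Require Import all_classical all_reals all_analysis.

Set Implicit Arguments.
Unset Strict Implicit.
Unset Printing Implicit Defensive.
Import Order.TTheory GRing.Theory Num.Theory.
Import numFieldNormedType.Exports.

Local Open Scope classical_set_scope.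
Local Open Scope ring_scope.
Local Open Scope complex_scope.

(* The norm of a normed module over the complex field [R[i]] takes its values in
   [R[i]]; [rnorm] is the same norm as an element of [R]. *)
Definition rnorm (R : realType) (E : normedZmodType R[i]) (x : E) : R :=
  complex.Re `|x|.

Section rnorm_theory.
Context (R : realType) (E : normedZmodType R[i]).
Implicit Types x y : E.

Lemma rnormE x : (rnorm x)%:C = `|x|.
Proof. by rewrite /rnorm RRe_real// ger0_real. Qed.

Lemma rnorm_ge0 x : 0 <= rnorm x.
Proof. by rewrite -lecR rnormE; exact: normr_ge0. Qed.

Lemma ler_rnormD x y : rnorm (x + y) <= rnorm x + rnorm y.
Proof. by rewrite -lecR rmorphD /= !rnormE ler_normD. Qed.

Lemma rnorm0_eq0 x : rnorm x = 0 -> x = 0.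
Proof. by move=> x0; apply/eqP; rewrite -normr_eq0 -rnormE x0. Qed.

Lemma rnorm0 : rnorm (0 : E) = 0.
Proof. by rewrite /rnorm normr0. Qed.

End rnorm_theory.

Lemma rnormM (R : realType) (a b : R[i]) : rnorm (a * b) = rnorm a * rnorm b.
Proof. by apply: complexI; rewrite rmorphM /= !rnormE normrM. Qed.

(* The [ell_q] norm, [1 <= q <= +oo], of any complex sequence ([+oo] if the
   sequence is not in [ell_q]). *)
Definition ell_norm (R : realType) (q : \bar R) (x : nat -> R[i]) : \bar R :=
  ('N[counting]_q [EFin \o (fun n => rnorm (x n))])%E.

Section ell_norm_theory.
Context (R : realType) (p : R) (p1 : 1 <= p).
Implicit Types x y : nat -> R[i].

Let p_gt0 : 0 < p. Proof. exact: lt_le_trans p1. Qed.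

Lemma ell_normE x :
  ell_norm p%:E x =
  ((\sum_(0 <= k <oo) (rnorm (x k) `^ p)%:E) `^ p^-1)%E.
Proof.
rewrite /ell_norm Lnorm_counting//; congr (_ `^ _)%E; apply: eq_eseriesr.
by move=> k _ /=; rewrite ger0_norm ?rnorm_ge0.
Qed.

Lemma ell_norm_ge0 x : (0 <= ell_norm p%:E x)%E.
Proof. exact: Lnorm_ge0. Qed.

Lemma ell_norm0 : ell_norm p%:E (0 : nat -> R[i]) = 0%E.
Proof.
rewrite ell_normE eseries0 ?poweR0r ?invr_neq0 ?gt_eqF// => k _ _ /=.
by rewrite rnorm0 powR0// gt_eqF.
Qed.

Lemma ell_normD x y :
  (ell_norm p%:E (x + y)%R <= ell_norm p%:E x + ell_norm p%:E y)%E.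
Proof.
have /(_ _ nat counting (fun n => rnorm (x n)) (fun n => rnorm (y n)) p) h :=
  @minkowski_EFin _ _ R.
apply: le_trans (h _ _ p1) => //.
rewrite ell_normE Lnorm_counting//.
apply: gt0_ler_poweR; rewrite ?invr_ge0 ?(ltW p_gt0)//.
- by rewrite in_itv/= leey andbT nneseries_ge0// => *; rewrite lee_fin powR_ge0.
- by rewrite in_itv/= leey andbT nneseries_ge0// => *; rewrite poweR_ge0.
apply: lee_nneseries => [k _ _|k _]; first by rewrite lee_fin powR_ge0.
rewrite /= lee_fin ge0_ler_powR ?nnegrE ?rnorm_ge0 ?(ltW p_gt0)//.
exact: le_trans (ler_rnormD _ _) (ler_norm _).
Qed.

Lemma ell_normZ (a : R[i]) x :
  ell_norm p%:E (a *: x) = ((rnorm a)%:E * ell_norm p%:E x)%E.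
Proof.
rewrite !ell_normE.
rewrite (@eq_eseriesr _ _ (fun k => (rnorm a `^ p)%:E * (rnorm (x k) `^ p)%:E)%E).
  rewrite nneseriesZl => [|k _]; last by rewrite lee_fin powR_ge0.
  rewrite poweRM ?lee_fin ?powR_ge0// ?nneseries_ge0//; last first.
    by move=> *; rewrite lee_fin powR_ge0.
  by rewrite poweR_EFin -powRrM mulfV ?gt_eqF// powRr1 ?rnorm_ge0.
by move=> k _; rewrite -EFinM -powRM ?rnorm_ge0// -rnormM.
Qed.

Lemma ell_norm_eq0 x : ell_norm p%:E x = 0%E -> x = 0.
Proof.
rewrite ell_normE => /eqP.
rewrite poweR_eq0 ?nneseries_ge0//; last by move=> *; rewrite lee_fin powR_ge0.
move=> /andP[/eqP s0 _]; apply/funext => k; apply: rnorm0_eq0.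
have pos n : (0 <= (rnorm (x n) `^ p)%:E)%E by rewrite lee_fin powR_ge0.
have : ((rnorm (x k) `^ p)%:E <= 0)%E.
  rewrite -s0; apply: le_trans (nneseries_lim_ge k.+1 _) => //.
  by rewrite big_nat_recr//= leeDr// sume_ge0.
rewrite lee_fin => xk.
by apply/eqP/(contraTT _ xk) => xk0; rewrite -ltNge powR_gt0// lt_neqAle eq_sym xk0 rnorm_ge0.
Qed.

End ell_norm_theory.

Definition ell_pred (R : realType) (p : R) : {pred nat -> R[i]} :=
  mem [set x : nat -> R[i] | (ell_norm p%:E x < +oo)%E].

(* The proof that [1 <= p] is a parameter of the type, as in [LfunType]. *)
Record ell (R : realType) (p : R) (p1 : 1 <= p) :=
  Ell { ell_seq :> nat -> R[i] ; ell_seqP : ell_seq \in ell_pred p }.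

Section ell_normed_module.
Context (R : realType) (p : R) (p1 : 1 <= p).

HB.instance Definition _ := [isSub for @ell_seq R p p1].
HB.instance Definition _ := [Choice of ell p1 by <:].

Lemma ell_submod_closed : submod_closed (ell_pred p).
Proof.
split; first by rewrite inE/= ell_norm0.
move=> a x y; rewrite !inE/= => xoo yoo.
apply: (le_lt_trans (ell_normD p1 _ _)); rewrite lte_add_pinfty//.
by rewrite ell_normZ// lte_mul_pinfty// lee_fin rnorm_ge0.
Qed.

HB.instance Definition _ :=
  GRing.isSubmodClosed.Build _ _ (ell_pred p) ell_submod_closed.
HB.instance Definition _ := [SubChoice_isSubLmodule of ell p1 by <:].

Definition ell_cnorm (x : ell p1) : R[i] := (fine (ell_norm p%:E x))%:C.

Lemma ell_norm_fineK (x : ell p1) :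
  (fine (ell_norm p%:E x))%:E = ell_norm p%:E x.
Proof.
rewrite fineK// ge0_fin_numE ?ell_norm_ge0//.
by have := ell_seqP x; rewrite inE.
Qed.

Lemma ler_ell_cnormD (x y : ell p1) :
  ell_cnorm (x + y) <= ell_cnorm x + ell_cnorm y.
Proof.
by rewrite -rmorphD lecR -lee_fin EFinD !ell_norm_fineK ell_normD.
Qed.

Lemma ell_cnormZ (a : R[i]) (x : ell p1) :
  ell_cnorm (a *: x) = `|a| * ell_cnorm x.
Proof.
rewrite -rnormE -rmorphM; congr _%:C; apply: EFin_inj.
by rewrite EFinM !ell_norm_fineK ell_normZ.
Qed.

Lemma ell_cnorm_eq0 (x : ell p1) : ell_cnorm x = 0 -> x = 0.
Proof.
move=> /complexI x0; apply/val_inj/(ell_norm_eq0 p1).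
by rewrite -ell_norm_fineK x0.
Qed.

HB.instance Definition _ := @Lmodule_isNormed.Build R[i] (ell p1)
  ell_cnorm ler_ell_cnormD ell_cnormZ ell_cnorm_eq0.

End ell_normed_module.

Section holomorphic.
Context (R : realType) (E F : normedModType R[i]).

Definition multilinear n (A : ('I_n -> E) -> F) : Prop :=
  forall (v : 'I_n -> E) (i : 'I_n),
    linear (fun x : E => A (dfwith v i x)).

Definition homog_poly n (P : E -> F) : Prop :=
  exists2 A : ('I_n -> E) -> F, multilinear A & P = fun x => A (fun=> x).

Definition is_taylor (f : E -> F) (x0 : E) (P : nat -> E -> F) : Prop :=
  (forall n, homog_poly n (P n) /\ continuous (P n)) /\
  exists2 e : R[i], 0 < e &
    {uniform ball x0 e,
      (fun N x => \sum_(n < N) P n (x - x0)) @ \oo --> f}.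

Definition holomorphic (f : E -> F) : Prop :=
  forall x0, exists P, is_taylor f x0 P.

(* [P_n f(x0)], for [f] holomorphic; the Taylor series at [x0] is unique. *)
Definition taylor (f : E -> F) (x0 : E) : nat -> E -> F :=
  get (is_taylor f x0).

Definition locally_compact_image (f : E -> F) : Prop :=
  forall x0, exists2 e : R[i], 0 < e & precompact (f @` ball x0 e).

Definition relatively_pcompact (p : R) (K : set F) : Prop :=
  exists2 x : nat -> F,
    (\sum_(0 <= n <oo) (rnorm (x n) `^ p)%:E < +oo)%E &
    K `<=` [set y | exists2 a : nat -> R[i],
      (ell_norm (hoelder_conjugate p%:E) a < 1)%E &
      series (fun n => a n *: x n) @ \oo --> y].

Definition locally_pcompact_image (p : R) (f : E -> F) : Prop :=
  forall x0, exists2 e : R[i], 0 < e & relatively_pcompact p (f @` ball x0 e).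

Definition pcompact_taylor (p : R) (f : E -> F) : Prop :=
  forall x0 n, relatively_pcompact p (taylor f x0 n @` ball 0 1).

Definition balanced (K : set E) : Prop :=
  forall (a : R[i]) x, `|a| <= 1 -> K x -> K (a *: x).

Definition nachbin_seminorm (K : set E) (a : nat -> R[i]^o) (f : E -> F)
    : \bar R :=
  (\sum_(0 <= n <oo) ereal_sup
    [set (rnorm (taylor f 0%R n (k + a n *: b)%R))%:E
      | k in K & b in ball (0%R : E) 1%R])%E.

End holomorphic.

Section compact_holomorphic.
Context (R : realType) (E F : normedModType R[i]).

Lemma uniform_cvgP (A : set E) (u : nat -> E -> F) (f : E -> F) :
  {uniform A, u @ \oo --> f} <->
  forall e : R[i], 0 < e ->
    \forall N \near \oo, forall x, A x -> `|f x - u N x| < e.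
Proof.
split => [uf e e0|uf].
  have : nbhs (f : uniform_fun A F) [set h | forall x, A x -> `|f x - h x| < e].
    apply/uniform_nbhs; exists [set xy | ball xy.1 e xy.2]; split.
      exact: entourage_ball (PosNum e0).
    by move=> h /= H x Ax; have := H x Ax; rewrite -ball_normE.
  by move/uf.
move=> P /uniform_nbhs[V [/= entV VP]].
have [e /= e0 eV] : exists2 e : R[i], 0 < e & [set xy | ball xy.1 e xy.2] `<=` V.
  by move: entV; rewrite -entourage_ballE => -[e e0 eV]; exists e.
near=> N; apply: VP => x Ax /=; apply: eV => /=; rewrite -ball_normE /=.
by move: x Ax; near: N; exact: uf.
Unshelve. all: by end_near. Qed.

Definition cholo_pred : {pred E -> F} :=
  mem [set f : E -> F | holomorphic f /\ locally_compact_image f].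

Lemma homog_poly_submod n (a : R[i]) (P Q : E -> F) :
  homog_poly n P -> homog_poly n Q -> homog_poly n (a *: P + Q).
Proof.
move=> [A linA ->] [B linB ->].
exists (fun v => a *: A v + B v) => [v i b x y|//].
rewrite (linA v i) (linB v i) !scalerDr !scalerA (mulrC a b) -!addrA.
by congr (_ + _); rewrite addrCA.
Qed.

Lemma common_radius (e1 e2 : R[i]) : 0 < e1 -> 0 < e2 ->
  exists2 e, 0 < e & e <= e1 /\ e <= e2.
Proof.
move=> e10 e20; have : e1 >=< e2 by rewrite real_comparable// gtr0_real.
by move=> /orP[e12|e21]; [exists e1|exists e2].
Qed.

Lemma is_taylor_submod (a : R[i]) (f g : E -> F) x0 P Q :
  is_taylor f x0 P -> is_taylor g x0 Q ->
  is_taylor (a *: f + g) x0 (fun n => a *: P n + Q n).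
Proof.
move=> [hP [e1 e10 fP]] [hQ [e2 e20 gQ]]; split => [n|].
  have [hPn cPn] := hP n; have [hQn cQn] := hQ n.
  split; first exact: homog_poly_submod.
  by move=> x; apply: cvgD; [apply: cvgZr; exact: cPn|exact: cQn].
have [e e0 [ee1 ee2]] := common_radius e10 e20.
exists e => //; apply/uniform_cvgP => d d0.
have na : 0 < `|a| + 1 by rewrite ltr_wpDl.
have d20 : 0 < d / 2 by rewrite divr_gt0// ltr0n.
move/uniform_cvgP : fP => /(_ _ (divr_gt0 d20 na)) fP.
move/uniform_cvgP : gQ => /(_ _ d20) gQ.
near=> N => x xe.
have -> : (a *: f + g) x - \sum_(n < N) (a *: P n + Q n) (x - x0) =
    a *: (f x - \sum_(n < N) P n (x - x0)) + (g x - \sum_(n < N) Q n (x - x0)).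
  rewrite big_split/= -scaler_sumr scalerBr opprD !addrA; congr (_ + _).
  by rewrite addrAC.
rewrite (le_lt_trans (ler_normD _ _))// [ltRHS]splitr ltr_leD//; last first.
  apply: ltW; move: x xe; near: N; apply: filterS gQ => N gN x xe.
  by apply: gN; exact: le_ball xe.
rewrite normrZ (@le_lt_trans _ _ ((`|a| + 1) * `|f x - \sum_(n < N) P n (x - x0)|))//.
  by rewrite ler_wpM2r// lerDl.
rewrite mulrC -ltr_pdivlMr//; move: x xe; near: N; apply: filterS fP => N fN x xe.
by apply: fN; exact: le_ball xe.
Unshelve. all: by end_near. Qed.

Lemma cholo_submod_closed : submod_closed cholo_pred.
Proof.
split=> [|a f g]; rewrite !inE/=.
  split=> x0.
    exists (fun=> 0); split => [n|].
      split; last exact: cst_continuous.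
      by exists (fun=> 0) => // v i b x y; rewrite scaler0 addr0.
    exists 1; first exact: ltr01.
    apply/uniform_cvgP => e e0; near=> N => x _.
    by rewrite big1// subr0 normr0.
  exists 1; first exact: ltr01.
  apply: (@precompact_subset _ _ [set 0]); first by move=> _ [x _ <-].
  rewrite precompact_closed; first exact: compact_set1.
  by apply: compact_closed; [exact: norm_hausdorff|exact: compact_set1].
move=> [hf cf] [hg cg]; split=> x0.
  have [P fP] := hf x0; have [Q gQ] := hg x0.
  by exists (fun n => a *: P n + Q n); exact: is_taylor_submod.
have [e1 e10 c1] := cf x0; have [e2 e20 c2] := cg x0.
have [e e0 [ee1 ee2]] := common_radius e10 e20; exists e => //.
rewrite !precompactE in c1 c2.
pose h (y : F * F) := a *: y.1 + y.2.
have ch : continuous h.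
  move=> y; apply: cvgD; last exact: cvg_snd.
  by apply: cvgZr; exact: cvg_fst.
have ck := continuous_compact (continuous_subspaceT ch) (compact_setX c1 c2).
apply: (@precompact_subset _ _ _ _ (_ : precompact (h @` _))); last first.
  rewrite precompact_closed; first exact: ck.
  by apply: compact_closed ck; exact: norm_hausdorff.
move=> _ [x xe <-] /=; exists (f x, g x) => //; split=> /=; apply: subset_closure.
  by exists x => //; exact: le_ball xe.
by exists x => //; exact: le_ball xe.
Unshelve. all: by end_near. Qed.

End compact_holomorphic.

(* The space of compact holomorphic functions from [E] to [F], with the topology
   induced by the Nachbin topology [tau_omega]: the coarsest topology for which
   all the balls of the Nachbin seminorms (centered at elements of the space)
   are open. Balls are indexed by (center, K, (alpha_n), radius). *)
Record cholo (R : realType) (E F : normedModType R[i]) :=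
  Cholo { cholo_fun :> E -> F ; cholo_funP : cholo_fun \in @cholo_pred R E F }.

Section nachbin_topology.
Context (R : realType) (E F : normedModType R[i]).

HB.instance Definition _ := [isSub for @cholo_fun R E F].
HB.instance Definition _ := [Choice of cholo E F by <:].
HB.instance Definition _ :=
  GRing.isSubmodClosed.Build _ _ (@cholo_pred R E F) (@cholo_submod_closed R E F).
HB.instance Definition _ := [SubChoice_isSubLmodule of cholo E F by <:].
HB.instance Definition _ := isPointed.Build (cholo E F) 0.

Record nachbin_index := NachbinIndex {
  nachbin_center : cholo E F ;
  nachbin_set : set E ;
  nachbin_seq : nat -> R[i]^o ;
  nachbin_radius : R }.

HB.instance Definition _ := gen_eqMixin nachbin_index.
HB.instance Definition _ := gen_choiceMixin nachbin_index.
HB.instance Definition _ := isPointed.Build nachbin_index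
  (NachbinIndex 0 set0 (fun=> 0) 0).

Definition nachbin_dom : set nachbin_index :=
  [set i | [/\ nachbin_set i !=set0, compact (nachbin_set i),
    balanced (nachbin_set i), nachbin_seq i @ \oo --> (0 : R[i]^o) &
    0 < nachbin_radius i]].

Definition nachbin_ball (i : nachbin_index) : set (cholo E F) :=
  [set g | (nachbin_seminorm (nachbin_set i) (nachbin_seq i)
              (g - nachbin_center i)%R < (nachbin_radius i)%:E)%E].

HB.instance Definition _ :=
  isSubBaseTopological.Build (cholo E F) nachbin_dom nachbin_ball.

End nachbin_topology.

Section spaceable.
Context (K : numDomainType) (X : preTopologicalLmodType K).

Definition finite_dimensional (V : set X) : Prop :=
  exists n (v : 'I_n -> X),
    V `<=` [set x | exists c : 'I_n -> K, x = \sum_(i < n) c i *: v i].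

Definition spaceable (A : set X) : Prop :=
  exists V : set X, [/\ submod_closed [in V], closed V,
    ~ finite_dimensional V & V `<=` A `|` [set 0]].

End spaceable.

(* Main.v *)
(** Give every coordinate [j] a degree and a class so that, for each [k < n], the
    class [k] contains at least [n ^ n] coordinates of degree [n], and for each
    sequence [c] consider the diagonal map [f x j = c (class j) * x j ^+ degree j].
    Whenever such a map is holomorphic, its coefficients grow at most
    geometrically in the degree; since the degrees tend to infinity, the map is
    then compact, and its Taylor polynomials [h |-> (w j * h j ^+ m)_j] have
    [w] in [ell_1], which makes them [p]-compact. By Hoelder, if the image of a
    ball of radius [2 * s] around [0] were relatively [p]-compact, then
    [\sum_j |c (class j) * s ^ degree j| ^ p] would be finite; as soon as
    [c k != 0] the blocks of class [k] contribute at least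
    [n ^ n * s ^ (n * p) * |c k| ^ p], which is unbounded. The shape of a diagonal
    map is read off its Taylor coefficients at [0], which are continuous for the
    Nachbin topology, so the identity theorem shows that these maps form a closed
    subspace. *)

Require Import Defs.
From mathcomp Require Import all_boot all_order all_algebra.
From mathcomp Require Import complex.
From mathcomp Require Import all_classical all_reals all_analysis.
From mathcomp Require Import ess_sup_inf ring lra.

Set Implicit Arguments.
Unset Strict Implicit.
Unset Printing Implicit Defensive.

Import Order.TTheory GRing.Theory Num.Theory.
Import numFieldNormedType.Exports.

Local Open Scope classical_set_scope.
Local Open Scope ring_scope.

(** * Norm estimates for complex sequences *)

Section ell_sequences.
Context (R : realType).
Local Notation C := R[i].
Implicit Types (s t : nat -> C) (M : R).

Lemma rnorm_C (x : R) : rnorm (x%:C%C : C) = `|x|.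
Proof. by rewrite /rnorm normc_def /= expr0n /= addr0 sqrtr_sqr. Qed.

Lemma rnormX (a : C) n : rnorm (a ^+ n) = rnorm a ^+ n.
Proof.
elim: n => [|n IH]; last by rewrite !exprS rnormM IH.
by rewrite !expr0 /rnorm normr1.
Qed.

Lemma rnorm_prod n (a : 'I_n -> C) : rnorm (\prod_i a i) = \prod_i rnorm (a i).
Proof.
elim/big_rec2: _ => [|i x y _ <-]; last by rewrite rnormM.
by rewrite /rnorm normr1.
Qed.

Lemma rnorm_nat n : rnorm (n%:R : C) = n%:R.
Proof. by rewrite /rnorm normr_nat -(rmorph_nat (@real_complex R)) /=. Qed.

Lemma rnormN (E : normedZmodType C) (x : E) : rnorm (- x) = rnorm x.
Proof. by rewrite /rnorm normrN. Qed.

Lemma rnormB (E : normedZmodType C) (x y : E) : rnorm (x - y) = rnorm (y - x).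
Proof. by rewrite /rnorm distrC. Qed.

Lemma rnormZ (E : normedModType C) (a : C) (x : E) :
  rnorm (a *: x) = rnorm a * rnorm x.
Proof. by apply: complexI; rewrite rmorphM /= !rnormE normrZ. Qed.

Lemma ler_rnorm_sum (E : normedZmodType C) n (F : 'I_n -> E) :
  rnorm (\sum_(i < n) F i) <= \sum_(i < n) rnorm (F i).
Proof.
elim/big_rec2: _ => [|i x y _ h]; first by rewrite rnorm0.
exact: le_trans (ler_rnormD _ _) (lerD _ _).
Qed.

Lemma ball_rnorm (E : normedModType C) (x y : E) (e : C) : 0 < e ->
  ball x e y <-> rnorm (x - y) < complex.Re e.
Proof.
move=> e0; rewrite -ball_normE /=.
have -> : e = (complex.Re e)%:C%C by rewrite RRe_real// gtr0_real.
by rewrite -rnormE ltcR.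
Qed.

Lemma ltcR0 (e : R) : (0 < e%:C%C :> C) = (0 < e).
Proof. by rewrite ltcR. Qed.

Lemma Re_gt0 (e : C) : 0 < e -> 0 < complex.Re e.
Proof. by move=> e0; rewrite -ltcR RRe_real// gtr0_real. Qed.

(** Membership in [ell_1] with norm at most [M], expressed by finite sums so that estimates on raw
    sequences stay in [R]. *)
Definition l1_bounded s M := forall N, \sum_(i < N) rnorm (s i) <= M.

Lemma l1_bounded_ge0 s M : l1_bounded s M -> 0 <= M.
Proof. by move/(_ 0); rewrite big_ord0. Qed.

Lemma l1_bounded_coord s M k : l1_bounded s M -> rnorm (s k) <= M.
Proof.
move=> /(_ k.+1); rewrite big_ord_recr /=; apply: le_trans.
by rewrite lerDr sumr_ge0// => i _; exact: rnorm_ge0.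
Qed.

Lemma l1_bounded_le s t M : (forall k, rnorm (s k) <= rnorm (t k)) ->
  l1_bounded t M -> l1_bounded s M.
Proof. by move=> st tM N; apply: le_trans (tM N); apply: ler_sum. Qed.

Lemma l1_bounded_leZ s t M c : 0 <= c ->
  (forall k, rnorm (s k) <= c * rnorm (t k)) ->
  l1_bounded t M -> l1_bounded s (c * M).
Proof.
move=> c0 st tM N; apply: (@le_trans _ _ (\sum_(i < N) c * rnorm (t i))).
  exact: ler_sum.
by rewrite -mulr_sumr ler_wpM2l.
Qed.

(** The contractive inclusion of [ell_1] in [ell_q]. For finite [q], write [x ^ q = x * x ^ (q - 1)]
    and bound the second factor by [M ^ (q - 1)], since every coordinate is at most [M]. *)
Lemma ell_norm_le_l1 s M (q : \bar R) : (1 <= q)%E -> l1_bounded s M ->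
  (ell_norm q s <= M%:E)%E.
Proof.
move=> q1 sM; have M0 := l1_bounded_ge0 sM.
case: q q1 => [q|_|//]; last first.
  rewrite /ell_norm unlock /=; case: ifPn => _; last by rewrite lee_fin.
  apply/ess_supP/nearW => k /=.
  by rewrite lee_fin ger0_norm ?rnorm_ge0//; exact: l1_bounded_coord.
rewrite lee_fin => q1; have q0 : 0 < q by exact: lt_le_trans q1.
rewrite ell_normE//.
have -> : M%:E = ((M `^ q)%:E `^ q^-1)%E.
  by rewrite poweR_EFin -powRrM mulfV ?gt_eqF// powRr1.
apply: gt0_ler_poweR; rewrite ?invr_ge0 ?(ltW q0)//.
- by rewrite in_itv/= leey andbT nneseries_ge0// => *; rewrite lee_fin powR_ge0.
- by rewrite in_itv/= leey andbT lee_fin powR_ge0.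
apply: lime_le.
  by apply: is_cvg_nneseries => *; rewrite lee_fin powR_ge0.
apply: nearW => N; rewrite sumEFin lee_fin big_mkord.
have powE x : 0 <= x -> x `^ q = x * x `^ (q - 1).
  move=> x0; have [->|xn0] := eqVneq x 0; first by rewrite mul0r powR0 ?gt_eqF.
  rewrite -{2}(powRr1 x0) -powRD ?(addrC 1) ?subrK//.
  by rewrite xn0 implybT.
apply: (@le_trans _ _ (\sum_(i < N) rnorm (s i) * M `^ (q - 1))); last first.
  by rewrite -mulr_suml powE// ler_wpM2r// powR_ge0.
apply: ler_sum => i _; rewrite powE ?rnorm_ge0// ler_wpM2l ?rnorm_ge0//.
by rewrite ge0_ler_powR ?subr_ge0// ?nnegrE ?rnorm_ge0//;
  exact: l1_bounded_coord.
Qed.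

Lemma ell_norm_coord_le (q : \bar R) s k : (1 <= q)%E ->
  ((rnorm (s k))%:E <= ell_norm q s)%E.
Proof.
case: q => [q|_|//]; last first.
  rewrite /ell_norm unlock /=.
  (* Nonempty sets have positive counting measure, so an essential bound holds at every
     coordinate. *)
  have h (A : set nat) x : A x -> (0 < (counting A : \bar R))%E.
    move=> Ax; rewrite /counting; case: asboolP => [fA|_]; last by rewrite ltry.
    rewrite lte_fin ltr0n finmap.cardfs_gt0; apply/finmap.fset0Pn; exists x.
    by rewrite in_fset_set// inE.
  rewrite (h _ 0)//; have := @ess_sup_ge _ _ _ (@counting nat R)
    (abse \o [eta EFin \o (fun n => rnorm (s n))]).
  move=> [A [mA A0 /= hA]]; rewrite leNgt; apply/negP => hk.
  have /h : A k by apply: hA => /=; apply/negP;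
    rewrite -ltNge ger0_norm ?rnorm_ge0.
  by rewrite A0 ltxx.
rewrite lee_fin => q1; have q0 : 0 < q by exact: lt_le_trans q1.
have pos n : (0 <= (rnorm (s n) `^ q)%:E)%E by rewrite lee_fin powR_ge0.
rewrite ell_normE//.
have -> : (rnorm (s k))%:E = ((rnorm (s k) `^ q)%:E `^ q^-1)%E.
  by rewrite poweR_EFin -powRrM mulfV ?gt_eqF// powRr1// rnorm_ge0.
apply: gt0_ler_poweR; rewrite ?invr_ge0 ?(ltW q0)//.
- by rewrite in_itv/= leey andbT.
- by rewrite in_itv/= leey andbT nneseries_ge0.
apply: le_trans (nneseries_lim_ge k.+1 _) => //.
by rewrite big_nat_recr//= leeDr// sume_ge0.
Qed.

End ell_sequences.

(** * Elements of [ell_p] given by absolutely summable sequences, and their tails *)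

Section ell_elements.
Context (R : realType) (p : R) (p1 : 1 <= p).
Local Notation C := R[i].
Implicit Types (s : nat -> C) (x y : ell p1).

Lemma ell_ext x y : (forall k, x k = y k) -> x = y.
Proof. by move=> xy; apply/val_inj/funext. Qed.

Lemma ellD x y k : (x + y) k = x k + y k. Proof. by []. Qed.

Lemma ellB x y k : (x - y) k = x k - y k. Proof. by []. Qed.

Lemma ellZ (a : C) x k : (a *: x) k = a * x k. Proof. by []. Qed.

Lemma ell_sum n (F : 'I_n -> ell p1) k : (\sum_(i < n) F i) k = \sum_(i < n) F
  i k.
Proof. by elim/big_rec2: _ => // i x y _ <-. Qed.

Lemma rnorm_ellE x : (rnorm x)%:E = ell_norm p%:E x.
Proof. by rewrite -ell_norm_fineK. Qed.

Lemma rnorm_coord_le x k : rnorm (x k) <= rnorm x.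
Proof. by rewrite -lee_fin rnorm_ellE ell_norm_coord_le. Qed.

(** Total on sequences, with value 0 outside [ell_p]; every use therefore passes through a bound
    that feeds [to_ellE]. *)
Definition to_ell s : ell p1 := insubd 0 s.

Lemma to_ellE s M : l1_bounded s M -> to_ell s = s :> (nat -> C).
Proof.
move=> sM; have := insubdK (0 : ell p1) (_ : s \in ell_pred p); apply.
rewrite inE /=; apply: le_lt_trans (ell_norm_le_l1 _ sM) _;
  last by rewrite ltry.
by rewrite lee_fin.
Qed.

Lemma rnorm_le_l1 x M : l1_bounded x M -> rnorm x <= M.
Proof.
by move=> sM; rewrite -lee_fin rnorm_ellE; apply: ell_norm_le_l1.
Qed.

Lemma rnorm_to_ell s M : l1_bounded s M -> rnorm (to_ell s) <= M.
Proof. by move=> sM; apply: rnorm_le_l1; rewrite (to_ellE sM). Qed.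

Lemma l1_delta (a : C) j : l1_bounded (fun k => a *+ (k == j)) (rnorm a).
Proof.
move=> N; apply: (@le_trans _ _ (\sum_(i < N | i == j :> nat) rnorm a)).
  rewrite [leRHS]big_mkcond; apply: ler_sum => i _.
  by case: eqP; rewrite ?mulr1n ?mulr0n ?rnorm0.
have [jN|Nj] := ltnP j N.
  by rewrite (big_pred1 (Ordinal jN)).
rewrite big_pred0 ?rnorm_ge0// => i; apply/negbTE; rewrite neq_ltn.
by rewrite (leq_trans (ltn_ord i) Nj).
Qed.

Definition delta (a : C) j : ell p1 := to_ell (fun k => a *+ (k == j)).

Lemma deltaE a j k : delta a j k = a *+ (k == j).
Proof. by rewrite /delta (to_ellE (l1_delta _ _)). Qed.

Lemma rnorm_delta a j : rnorm (delta a j) = rnorm a.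
Proof.
apply/eqP; rewrite eq_le (rnorm_to_ell (l1_delta _ _)) /=.
by have := rnorm_coord_le (delta a j) j; rewrite deltaE eqxx.
Qed.

End ell_elements.

Lemma l1_rnorm (R : realType) (x : ell (lexx (1 : R))) : l1_bounded x (rnorm x).
Proof.
move=> N; rewrite -lee_fin rnorm_ellE ell_normE//.
rewrite invr1 poweRe1; last by apply: nneseries_ge0 => *;
  rewrite lee_fin powR_ge0.
rewrite (eq_eseriesr (g := fun k => (rnorm (x k))%:E)); last first.
  by move=> k _; rewrite powRr1// rnorm_ge0.
apply: le_trans (nneseries_lim_ge N _) => //.
  by rewrite big_mkord sumEFin.
by move=> *; rewrite lee_fin rnorm_ge0.
Qed.

Lemma nonneg_bounded_tail (R : realType) (u : nat -> R) (M e : R) :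
  (forall k, 0 <= u k) -> (forall N, \sum_(i < N) u i <= M) -> 0 < e ->
  exists J, forall N, \sum_(i < N | (J <= i)%N) u i <= e.
Proof.
move=> u0 uM e0; pose S := [set \sum_(i < N) u i | N in setT].
have hS : has_sup S.
  split; first by exists (\sum_(i < 0) u i), 0.
  by exists M => _ [N _ <-].
(* The partial sum up to [J] is within [e] of the supremum of all partial sums, so the terms from
   [J] on add at most [e]. *)
have [_ [J _ <-]] := sup_adherent e0 hS.
move=> hJ; exists J => N; have [NJ|JN] := leqP N J.
  rewrite big_pred0 ?(ltW e0)// => i; apply/negbTE.
  by rewrite -ltnNge (leq_trans (ltn_ord i) NJ).
have hN : \sum_(i < N) u i <= sup S by apply: sup_upper_bound => //; exists N.
move: hN; rewrite (bigID (fun i : 'I_N => (J <= i)%N)) /=.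
rewrite [X in _ + X](eq_bigl (fun i : 'I_N => (i < J)%N)); last first.
  by move=> i; rewrite -ltnNge.
rewrite (big_ord_narrow (ltnW JN)) /=; lra.
Qed.

Lemma l1_tail (R : realType) (s : nat -> R[i]) (M e : R) : l1_bounded s M -> 0
  < e ->
  exists J, forall N, \sum_(i < N | (J <= i)%N) rnorm (s i) <= e.
Proof.
by move=> sM e0; apply: (@nonneg_bounded_tail _ (fun k => rnorm (s k)) M) =>
  // k; exact: rnorm_ge0.
Qed.

Lemma l1_cvg0 (R : realType) (s : nat -> R[i]) (M e : R) : l1_bounded s M -> 0
  < e ->
  exists J, forall k, (J <= k)%N -> rnorm (s k) <= e.
Proof.
move=> sM e0; have [J hJ] := l1_tail sM e0; exists J => k Jk.
apply: le_trans (hJ k.+1); rewrite big_mkcond big_ord_recr /= Jk lerDr.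
by apply: sumr_ge0 => i _; case: ifP => // _; exact: rnorm_ge0.
Qed.

(** * Uniqueness of Taylor series and the identity theorem *)

Section taylor_series.
Context (R : realType) (E F : normedModType R[i]).
Local Notation C := R[i].
Implicit Types (f g h : E -> F) (x y v : E) (P Q : nat -> E -> F).

Lemma multilinearZ n (A : ('I_n -> E) -> F) (a : C) x : multilinear A ->
  A (fun=> a *: x) = a ^+ n *: A (fun=> x).
Proof.
(* The arguments are scaled one at a time: [w k] has its first [k] entries scaled, and each step
   pulls out one factor [a]. *)
move=> linA; pose w k (i : 'I_n) := if (i < k)%N then a *: x else x.
have step k : (k <= n)%N -> A (w k) = a ^+ k *: A (w 0%N).
  elim: k => [|k IH] kn; first by rewrite scale1r.
  pose i := Ordinal kn.
  have wS y : y = a *: x \/ y = x ->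
      dfwith (w k) i y = if y == a *: x then w k.+1 else w k.
    move=> hy; apply/funext => j; case: dfwithP => [|j' ij].
      case: ifPn => [/eqP ->|yx]; first by rewrite /w /= ltnSn.
      by case: hy yx => [->|->]; rewrite ?eqxx// /w ltnn.
    have jk : (j' != k :> nat) by rewrite eq_sym; apply: contra ij => /eqP ij;
      apply/eqP/val_inj.
    by case: ifP => // _; rewrite /w ltnS (leq_eqVlt j') (negbTE jk).
  have lin0 : A (dfwith (w k) i 0) = 0.
    have := linA (w k) i 1 0 0.
    by rewrite !scale1r addr0 => /eqP; rewrite -subr_eq subrr eq_sym => /eqP.
  have := linA (w k) i a x 0; rewrite addr0 lin0 addr0 wS; last by left.
  rewrite eqxx => ->; rewrite exprS -scalerA -IH ?(ltnW kn)//; congr (_ *: A _).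
  rewrite wS; last by right.
  by case: eqP => // ax; apply/funext => j; rewrite /w -ax !if_same.
have -> : (fun=> a *: x) = w n by apply/funext => i; rewrite /w ltn_ord.
by rewrite step.
Qed.

Lemma homog_polyZ n (P : E -> F) (a : C) x : homog_poly n P ->
  P (a *: x) = a ^+ n *: P x.
Proof. by move=> [A linA ->]; exact: multilinearZ. Qed.

Lemma is_taylor_cvg f x0 P : is_taylor f x0 P ->
  exists2 r : R, 0 < r & forall d : R, 0 < d -> exists N0, forall N x,
    (N0 <= N)%N -> rnorm (x - x0) < r ->
    rnorm (f x - \sum_(n < N) P n (x - x0)) < d.
Proof.
move=> [_ [e e0 /uniform_cvgP cvf]]; exists (complex.Re e); first exact: Re_gt0.
move=> d d0; have [N0 _ hN] := cvf d%:C%C (etrans (ltcR0 _) d0).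
exists N0 => N x N0N xr; have := hN N N0N x; rewrite -rnormE ltcR; apply.
by apply/ball_rnorm; rewrite // rnormB.
Qed.

Lemma geometric_sum_le (q : R) K : 0 <= q -> q <= 1 / 2 ->
  \sum_(i < K) q ^+ i <= 2.
Proof.
move=> q0 q2; have : \sum_(i < K) q ^+ i <= 2 - 2 * q ^+ K.
  elim: K => [|K IH]; first by rewrite big_ord0 expr0; lra.
  rewrite big_ord_recr /= exprS; have := exprn_ge0 K q0; nra.
have := exprn_ge0 K q0; lra.
Qed.

(** Strong induction on the degree: once the terms below [m] vanish, the equation [f = 0] at a small
    [t] balances the [m]-th term, of size [t ^ m * rnorm (P m v)], against higher terms of order
    [t ^ m.+1]. Asking only for zeros accumulating at [x0] along [v] serves both the uniqueness of
    the series and the identity theorem. *)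
Lemma is_taylor_vanish f x0 P v : is_taylor f x0 P ->
  (forall e : R, 0 < e -> exists2 t : R, 0 < t < e & f (x0 + t%:C%C *: v) = 0)
    ->
  forall n, P n v = 0.
Proof.
move=> fP hv; have [r0 r00 cvf] := is_taylor_cvg fP.
have hom n a : P n (a *: v) = a ^+ n *: P n v.
  by apply: homog_polyZ; case: fP => /(_ n)[].
pose r := r0 / (rnorm v + 1); have v0 := rnorm_ge0 v.
have r_gt0 : 0 < r by rewrite divr_gt0//; lra.
have small t : 0 <= t -> t <= r -> rnorm (t%:C%C *: v) < r0.
  move=> t0 tr; rewrite rnormZ rnorm_C ger0_norm//.
  apply: (@le_lt_trans _ _ (r * rnorm v)); first by rewrite ler_wpM2r.
  by rewrite /r mulrAC ltr_pdivrMr ?ltr_pM2l//; lra.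
(* Beyond [N0] a term is the difference of two consecutive partial sums, each within 1 of [f x],
   hence is at most 2; the finitely many earlier terms are added to the bound. *)
have [M M0 hM] : exists2 M : R, 0 <= M & forall n, rnorm (P n v) * r ^+ n <= M.
  have [N0 hN] := cvf 1 ltr01; pose x := x0 + r%:C%C *: v.
  have tE n : rnorm (P n (x - x0)) = rnorm (P n v) * r ^+ n.
    rewrite /x addrC addKr hom rnormZ rnormX rnorm_C ger0_norm ?(ltW r_gt0)//.
    by rewrite mulrC.
  have xr : rnorm (x - x0) < r0 by rewrite /x addrC addKr small// ltW.
  exists (2 + \sum_(n < N0) rnorm (P n (x - x0))).
    by rewrite addr_ge0// sumr_ge0// => i _; exact: rnorm_ge0.
  move=> n; rewrite -tE; have [nN|Nn] := ltnP n N0.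
    rewrite (bigD1 (Ordinal nN)) //= addrCA lerDl addr_ge0// sumr_ge0// => i _.
    exact: rnorm_ge0.
  have := hN _ _ Nn xr; have := hN _ _ (leqW Nn) xr; rewrite big_ord_recr /=.
  set S := \sum_(i < n) _ => h1 h2.
  apply: (@le_trans _ _ 2); last by rewrite lerDl sumr_ge0// => i _;
    exact: rnorm_ge0.
  have -> : P n (x - x0) = (f x - S) - (f x - (S + P n (x - x0))).
    move: (P n _) => b.
    by rewrite opprB [RHS]addrC addrA subrK addrAC subrr add0r.
  apply: le_trans (ler_rnormD _ _) _; rewrite rnormN; lra.
elim/ltn_ind => m IH; apply: rnorm0_eq0; apply/eqP;
  rewrite eq_le rnorm_ge0 andbT.
apply/ler_addgt0Pr => e e0; rewrite add0r.
(* For [t <= r / 2] the terms of degree above [m] form a geometric tail bounded by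
   [2 * M * (t / r) ^ m.+1 = t ^ m * (c * t)]. *)
pose c := 2 * M / r ^+ m.+1.
have c0 : 0 <= c by rewrite divr_ge0 ?mulr_ge0// exprn_ge0// ltW.
have e1 : 0 < Num.min (r / 2) (e / (c + 1)).
  by rewrite lt_min !divr_gt0//; lra.
have [t /andP[t0]] := hv _ e1; rewrite lt_min => /andP[tr te] ft.
apply: (@le_trans _ _ (c * t)); last first.
  move: te; rewrite ltr_pdivlMr; last lra.
  nra.
have tm : 0 < t ^+ m by rewrite exprn_gt0.
(* For this fixed [t], a partial sum approximates the value 0 of [f] up to an arbitrary [d]; it
   splits into the degrees below [m], the degree [m], and [K] further ones. *)
rewrite -(ler_pM2l tm); apply/ler_addgt0Pr => d d0.
have [N0 hN] := cvf d d0; pose K := N0.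
have tr0 : rnorm (x0 + t%:C%C *: v - x0) < r0.
  by rewrite addrC addKr small//; lra.
have := hN (m.+1 + K)%N _ (leq_addl _ _) tr0.
rewrite ft sub0r rnormN addrC addKr big_split_ord /= big_ord_recr /=.
rewrite big1 ?add0r => [|i _]; last by rewrite hom IH ?scaler0.
set a := P m _; set b := \sum_(i < K) _ => hab.
have aE : rnorm a = t ^+ m * rnorm (P m v).
  by rewrite /a hom rnormZ rnormX rnorm_C gtr0_norm.
have hb : rnorm b <= t ^+ m * (c * t).
  apply: le_trans (@ler_rnorm_sum _ _ _ (fun i =>
    P (m.+1 + i)%N (t%:C%C *: v))) _.
  have q0 : 0 <= t / r by rewrite divr_ge0// ltW.
  have q2 : t / r <= 1 / 2 by rewrite ler_pdivrMr//; lra.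
  apply: (@le_trans _ _ (\sum_(i < K) (M * (t / r) ^+ m.+1) * (t / r) ^+ i)).
    apply: ler_sum => i _; rewrite hom rnormZ rnormX rnorm_C gtr0_norm//.
    rewrite -mulrA -exprD expr_div_n [leRHS]mulrA ler_pdivlMr ?exprn_gt0//.
    by rewrite -mulrA mulrC ler_pM2r ?exprn_gt0.
  rewrite -mulr_sumr; apply: (@le_trans _ _ (M * (t / r) ^+ m.+1 * 2)).
    by rewrite ler_wpM2l ?mulr_ge0 ?exprn_ge0// geometric_sum_le.
  rewrite /c expr_div_n [t ^+ m.+1]exprS le_eqVlt; apply/orP; left; apply/eqP.
  by ring.
rewrite -aE; have -> : a = (a + b) - b by rewrite addrK.
apply: le_trans (ler_rnormD _ _) _; rewrite rnormN; lra.
Qed.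

(** The difference of the two series expands the zero function, which vanishes along every
    direction. *)
Lemma is_taylor_unique f x0 P Q :
  is_taylor f x0 P -> is_taylor f x0 Q -> P = Q.
Proof.
move=> fP fQ; have h := is_taylor_submod (-1) fP fQ.
apply/funext => n; apply/funext => v.
have : (-1 *: P n + Q n) v = 0.
  apply: (is_taylor_vanish h) => e e0; exists (e / 2); first by apply/andP;
    split; lra.
  by rewrite [LHS]addrC /GRing.scale /= scaleN1r subrr.
rewrite [LHS]addrC; move=> /eqP; rewrite {1}/GRing.scale /= scaleN1r subr_eq0.
by move/eqP.
Qed.

Lemma taylorE f x0 P : is_taylor f x0 P -> taylor f x0 = P.
Proof.
move=> fP; apply: (is_taylor_unique _ fP).
by apply: (@getPex _ (is_taylor f x0)); exists P.
Qed.

Lemma taylorP f x0 : holomorphic f -> is_taylor f x0 (taylor f x0).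
Proof. by move=> /(_ x0)[P fP]; rewrite (taylorE fP). Qed.

Lemma holomorphicB f g : holomorphic f -> holomorphic g ->
  holomorphic (f - g).
Proof.
move=> hf hg x0; have [P fP] := hf x0; have [Q gQ] := hg x0.
exists (fun n => -1 *: Q n + P n); have := is_taylor_submod (-1) gQ fP.
by rewrite scaleN1r addrC.
Qed.

Lemma taylorB f g x0 n : holomorphic f -> holomorphic g ->
  taylor (f - g) x0 n = taylor f x0 n - taylor g x0 n.
Proof.
move=> hf hg; have := is_taylor_submod (-1) (taylorP x0 hg) (taylorP x0 hf).
by rewrite scaleN1r addrC => /taylorE ->; rewrite scaleN1r addrC.
Qed.

(* Along the segment from [0] to [x] the Taylor coefficients at the supremum of
   the zero interval vanish, so the interval extends further. *)
Lemma holomorphic_eq0 h (e : R) : holomorphic h -> 0 < e ->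
  (forall x, rnorm x < e -> h x = 0) -> forall x, h x = 0.
Proof.
move=> hh e0 h0 x; apply: contrapT => hx.
pose Z := [set t : R | 0 <= t /\ forall s : R, 0 <= s <= t -> h (s%:C%C *: x) =
  0].
have x0 := rnorm_ge0 x.
pose t1 := e / (rnorm x + 1).
have t10 : 0 < t1 by rewrite divr_gt0//; lra.
have Zt1 : Z t1.
  split=> [|s /andP[s0 st]]; first exact: ltW.
  apply: h0; rewrite rnormZ rnorm_C ger0_norm//.
  apply: (@le_lt_trans _ _ (t1 * rnorm x)); first by rewrite ler_wpM2r.
  by rewrite /t1 mulrAC ltr_pdivrMr ?ltr_pM2l//; lra.
have ubZ : has_sup Z.
  split; first by exists t1.
  (* A member of [Z] above 1 would give [h x = 0]. *)
  exists 1 => t [t0 ht]; rewrite leNgt; apply/negP => t1'.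
  by apply: hx; rewrite -[x]scale1r; apply: ht; rewrite ler01 ltW.
have T0 : 0 < sup Z by apply: lt_le_trans t10 _; exact: sup_upper_bound.
have below s : 0 <= s -> s < sup Z -> h (s%:C%C *: x) = 0.
  move=> s0 /(sup_gt (ex_intro _ _ Zt1))[t [t0 ht] st]; apply: ht.
  by rewrite s0 ltW.
have hT := taylorP ((sup Z)%:C%C *: x) hh.
(* The known zeros lie on the segment before the supremum, hence the direction [- x]; homogeneity
   carries the vanishing over to [x]. *)
have van n : taylor h ((sup Z)%:C%C *: x) n (- x) = 0.
  apply: (is_taylor_vanish hT) => d d0.
  have m0 : 0 < Num.min d (sup Z) by rewrite lt_min d0.
  pose t := Num.min d (sup Z) / 2; have t0 : 0 < t by rewrite divr_gt0.
  have : t < Num.min d (sup Z) by rewrite /t; lra.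
  rewrite lt_min => /andP[td tT]; exists t; first by rewrite t0.
  by rewrite scalerN -scalerBl -rmorphB /=; apply: below; lra.
have [r r0 cvh] := is_taylor_cvg hT.
pose d := r / (rnorm x + 1) / 2.
have d0 : 0 < d by rewrite !divr_gt0//; lra.
have ZT : Z (sup Z + d).
  split=> [|s /andP[s0 sT]]; first by rewrite addr_ge0// ltW.
  have [sT'|Ts] := ltP s (sup Z); first exact: below.
  apply: rnorm0_eq0; apply/eqP; rewrite eq_le rnorm_ge0 andbT.
  apply/ler_addgt0Pr => b b0; rewrite add0r.
  have [N0 hN] := cvh b b0.
  have := hN N0 (s%:C%C *: x) (leqnn _).
  rewrite -scalerBl -rmorphB /= rnormZ rnorm_C ger0_norm; last lra.
  rewrite big1 ?subr0 => [h1|i _].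
    apply/ltW/h1; apply: (@le_lt_trans _ _ (d * rnorm x)).
      by rewrite ler_wpM2r//; lra.
    rewrite /d -mulrA mulrAC ltr_pdivrMr; last lra.
    by rewrite ltr_pM2l//; lra.
  have [hom _] := hT.1 i.
  have -> : (s - sup Z)%:C%C *: x = (- (s - sup Z)%:C%C) *: - x.
    by rewrite scalerN scaleNr opprK.
  by rewrite (homog_polyZ _ _ hom) van scaler0.
have := sup_upper_bound ubZ ZT; lra.
Qed.

End taylor_series.

Lemma continuous_rnorm (R : realType) (E F : normedModType R[i]) (f : E -> F) :
  (forall (x : E) (e : R), 0 < e -> exists2 d : R, 0 < d &
    forall y, rnorm (x - y) < d -> rnorm (f x - f y) < e) -> continuous f.
Proof.
move=> h x; apply/cvgrPdist_lt => e e0; have [d d0 hd] := h x _ (Re_gt0 e0).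
near=> y; have -> : e = (complex.Re e)%:C%C by rewrite RRe_real// gtr0_real.
rewrite -rnormE ltcR; apply: hd; apply/(@ball_rnorm _ _ _ _ d%:C%C).
  by rewrite ltcR0.
by near: y; apply: nbhsx_ballx; rewrite ltcR0.
Unshelve. all: by end_near. Qed.

(** * Diagonal maps and their Taylor series at every point *)

Section diagonal_function.
Context (R : realType) (p : R) (p1 : 1 <= p).
Local Notation C := R[i].
Local Notation E := (ell (lexx (1 : R))).
Local Notation F := (ell p1).

Lemma l1_bounded_eventually (s t : nat -> C) J c M : 0 <= c ->
  (forall j, (J <= j)%N -> rnorm (s j) <= c * rnorm (t j)) ->
  l1_bounded t M -> l1_bounded s (\sum_(i < J) rnorm (s i) + c * M).
Proof.
move=> c0 st tM N.
apply: (@le_trans _ _ (\sum_(i < J + N) rnorm (s i))).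
  rewrite addnC big_split_ord /= lerDl sumr_ge0// => i _; exact: rnorm_ge0.
rewrite big_split_ord /= lerD2l.
apply: (@le_trans _ _ (\sum_(i < N) c * rnorm (t (J + i)%N))).
  by apply: ler_sum => i _; apply: st; rewrite leq_addr.
rewrite -mulr_sumr ler_wpM2l//; apply: le_trans (tM (J + N)%N).
by rewrite big_split_ord /= lerDr sumr_ge0// => i _; exact: rnorm_ge0.
Qed.

Lemma bin_le_exp2 n m : ('C(n, m) <= 2 ^ n)%N.
Proof.
elim: n m => [|n IH] [|m] //=; first by rewrite bin0 expn_gt0.
by rewrite binS expnS mul2n -addnn leq_add.
Qed.

(** Induction splitting off one factor at a time. The hypothesis [1 <= r] allows the exponent [m]
    where [m - 1] would be sharp. *)
Lemma rnorm_expB_le (u v : C) (r : R) m : 1 <= r -> rnorm u <= r ->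
  rnorm v <= r -> rnorm (u ^+ m - v ^+ m) <= m%:R * r ^+ m * rnorm (u - v).
Proof.
move=> r1 ur vr; have r0 : 0 <= r by lra.
elim: m => [|m IH]; first by rewrite !expr0 subrr rnorm0 !mul0r.
have -> : u ^+ m.+1 - v ^+ m.+1 = u * (u ^+ m - v ^+ m) + (u - v) * v ^+ m.
  by rewrite !exprS; ring.
apply: le_trans (ler_rnormD _ _) _; rewrite !rnormM rnormX.
rewrite -natr1 mulrDl mul1r mulrDl lerD//.
  rewrite exprS mulrCA -!mulrA (mulrA (m%:R)) ler_pM ?rnorm_ge0//.
have vm : rnorm v ^+ m <= r ^+ m.+1.
  rewrite exprS -[leLHS]mul1r ler_pM ?exprn_ge0 ?rnorm_ge0//.
  by rewrite lerXn2r ?nnegrE ?rnorm_ge0.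
by rewrite mulrC ler_wpM2r ?rnorm_ge0.
Qed.

Section homogeneous.
Context (m : nat) (w : nat -> C) (W : R) (wW : l1_bounded w W).

Lemma l1_prod (v : 'I_m -> E) :
  l1_bounded (fun j => w j * \prod_i v i j) ((\prod_i rnorm (v i)) * W).
Proof.
apply: l1_bounded_leZ wW; first by apply: prodr_ge0 => i _; exact: rnorm_ge0.
move=> k; rewrite rnormM rnorm_prod mulrC ler_wpM2r ?rnorm_ge0//.
by apply: ler_prod => i _; rewrite rnorm_ge0 rnorm_coord_le.
Qed.

Lemma l1_pow (x : E) : l1_bounded (fun j => w j * x j ^+ m) (rnorm x ^+ m * W).
Proof.
have := l1_prod (fun=> x); rewrite prodr_const card_ord.
by under eq_fun do rewrite prodr_const card_ord.
Qed.

Lemma diagonal_homog_poly :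
  homog_poly m (fun x : E => to_ell p1 (fun j => w j * x j ^+ m)).
Proof.
exists (fun v : 'I_m -> E => to_ell p1 (fun j => w j * \prod_i v i j));
  last first.
  apply/funext => x; congr to_ell; apply/funext => j.
  by rewrite prodr_const card_ord.
move=> v i a x y.
pose T (z : E) : F := to_ell p1 (fun j => w j * \prod_i' dfwith v i z i' j).
(* The [i]-th argument enters each coordinate as the single factor [z j], so linearity holds
   coordinatewise. *)
have TE (z : E) j : T z j = w j * (z j * \prod_(i' < m | i' != i) v i' j).
  rewrite /T (to_ellE p1 (l1_prod (dfwith v i z))) (bigD1 i) //= dfwithin.
  congr (_ * (_ * _)); apply: eq_bigr => i' ii.
  by rewrite dfwithout// eq_sym.
suff: T (a *: x + y) = a *: T x + T y by [].
apply: ell_ext => j; rewrite ellD ellZ !TE ellD ellZ; ring.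
Qed.

Lemma diagonal_continuous :
  continuous (fun x : E => to_ell p1 (fun j => w j * x j ^+ m) : F).
Proof.
have W0 := l1_bounded_ge0 wW.
apply: continuous_rnorm => x e e0.
pose r := rnorm x + 1; have r1 : 1 <= r by rewrite lerDr rnorm_ge0.
(* A Lipschitz constant on the ball of radius [r]; the bound 1 on the distance from [x] keeps [y] in
   that ball. *)
pose c := m%:R * r ^+ m * W.
have c0 : 0 <= c by rewrite !mulr_ge0 ?exprn_ge0//; lra.
exists (Num.min 1 (e / (c + 1))); first by rewrite lt_min ltr01 divr_gt0//; lra.
move=> y; rewrite lt_min => /andP[xy1]; rewrite ltr_pdivlMr; last lra.
move=> xyd.
have yr : rnorm y <= r.
  have -> : y = x - (x - y) by rewrite opprB addrC subrK.
  by apply: le_trans (ler_rnormD _ _) _; rewrite rnormN /r lerD2l ltW.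
have xr : rnorm x <= r by rewrite lerDl.
apply: le_lt_trans (_ : rnorm (x - y) * c < _); last first.
  have := rnorm_ge0 (x - y); nra.
apply: rnorm_le_l1.
rewrite /c mulrA.
apply: (l1_bounded_leZ _ _ wW) => [|k].
  by rewrite !mulr_ge0 ?exprn_ge0 ?rnorm_ge0//; lra.
rewrite ellB !(to_ellE p1 (l1_pow _)) -mulrBr rnormM mulrC ler_wpM2r
  ?rnorm_ge0//.
have := @rnorm_expB_le (x k) (y k) r m r1 (le_trans (rnorm_coord_le _ _) xr)
  (le_trans (rnorm_coord_le _ _) yr).
move=> /le_trans; apply; rewrite mulrC ler_wpM2r ?mulr_ge0 ?exprn_ge0//;
  first lra.
by rewrite -ellB rnorm_coord_le.
Qed.

End homogeneous.

Context (a : nat -> C) (d : nat -> nat) (A B : R).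
Hypothesis B0 : 0 < B.
Hypothesis d_gt0 : forall j, (0 < d j)%N.
Hypothesis d_oo : forall m, exists J, forall j, (J <= j)%N -> (m <= d j)%N.
Hypothesis aAB : forall j, rnorm (a j) <= A * B ^+ d j.

Let A0 : 0 <= A.
Proof.
have := le_trans (rnorm_ge0 _) (aAB 0); rewrite pmulr_lge0//.
by rewrite exprn_gt0.
Qed.

Definition diagonal (x : E) : F := to_ell p1 (fun j => a j * x j ^+ d j).

(** The coefficient of [h j ^+ m] in the binomial expansion of [a j * (x j + h j) ^+ d j]. For
    [d j < m] the binomial coefficient vanishes, so the truncated subtraction does no harm. *)
Definition diagonal_coef (x : E) m j : C :=
  a j * ('C(d j, m)%:R * x j ^+ (d j - m)).

(** Once [m < d j], at least one factor [x j] is left, and it supplies the summability. The other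
    factors are eventually below [(2 * B)^-1], which cancels [B ^+ d j] and the bound [2 ^ d j] on
    the binomial, up to the constant [(2 * B) ^+ m.+1]. *)
Lemma l1_diagonal_coef (x : E) m : exists W, l1_bounded (diagonal_coef x m) W.
Proof.
have e0 : 0 < (2 * B)^-1 by rewrite invr_gt0 mulr_gt0.
have [J1 hJ1] := l1_cvg0 (l1_rnorm x) e0; have [J2 hJ2] := d_oo m.+1.
exists (\sum_(i < maxn J1 J2) rnorm (diagonal_coef x m i) +
  A * (2 * B) ^+ m.+1 * rnorm x).
apply: (@l1_bounded_eventually _ x (maxn J1 J2) (A * (2 * B) ^+ m.+1) (rnorm
  x)).
- by rewrite mulr_ge0// exprn_ge0// mulr_ge0// ltW.
- move=> j; rewrite geq_max => /andP[/hJ1 xj /hJ2 mj].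
  rewrite /diagonal_coef !rnormM rnormX rnorm_nat.
  rewrite -subnSK// exprS.
  apply: (@le_trans _ _ (A * B ^+ d j * (2 ^+ d j * (rnorm (x j) *
      ((2 * B)^-1 ^+ (d j - m.+1)))))).
    rewrite ler_pM ?rnorm_ge0 ?mulr_ge0 ?exprn_ge0 ?rnorm_ge0//.
    rewrite ler_pM ?mulr_ge0 ?exprn_ge0 ?rnorm_ge0//.
      by rewrite -natrX ler_nat bin_le_exp2.
    by rewrite ler_wpM2l ?rnorm_ge0// lerXn2r ?nnegrE ?rnorm_ge0 ?(ltW e0).
  rewrite le_eqVlt; apply/orP; left; apply/eqP.
  have {1 2}-> : (d j = m.+1 + (d j - m.+1))%N by rewrite subnKC.
  move: (d j - m.+1)%N => k.
  have BN : B ^+ k * 2 ^+ k * (2 * B)^-1 ^+ k = 1.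
    by rewrite -!exprMn (mulrC B) divff ?expr1n// mulf_neq0// gt_eqF.
  rewrite exprMn !exprD -[RHS]mulr1 -[X in _ = _ * X]BN; ring.
- exact: l1_rnorm.
Qed.

Lemma l1_diagonal (x : E) : exists M, l1_bounded (fun j => a j * x j ^+ d j) M.
Proof.
have [M hM] := l1_diagonal_coef x 0; exists M; apply: l1_bounded_le hM => k.
by rewrite /diagonal_coef bin0 mul1r subn0.
Qed.

Lemma diagonalE (x : E) j : diagonal x j = a j * x j ^+ d j.
Proof. by have [M hM] := l1_diagonal x; rewrite /diagonal (to_ellE _ hM). Qed.

Lemma diagonal_coef_polyE (x : E) m (h : E) j :
  to_ell p1 (fun j => diagonal_coef x m j * h j ^+ m) j = diagonal_coef x m j *
    h j ^+ m.
Proof. by have [W hW] := l1_diagonal_coef x m;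
  rewrite (to_ellE _ (l1_pow _ hW h)). Qed.

(** As [0 < N], every term of the tail contains a factor [v]. With that factor taken out, the rest
    is dominated by the full expansion of [(e + e) ^+ n] divided by [e]. *)
Lemma binomial_tail_le (u v : C) (e : R) n N : (0 < N)%N -> 0 < e ->
  rnorm u <= e -> rnorm v <= e ->
  rnorm (\sum_(m < n.+1 | (N <= m)%N) (u ^+ (n - m) * v ^+ m) *+ 'C(n, m)) <=
  rnorm v * (e^-1 * (2 * e) ^+ n).
Proof.
move=> N0 e0 ue ve; have -> : 2 * e = e + e by ring.
rewrite exprDn mulr_sumr mulr_sumr big_mkcond /=.
have := @ler_rnorm_sum _ _ n.+1 (fun m =>
  if (N <= m)%N then u ^+ (n - m) * v ^+ m *+ 'C(n, m) else 0).
move=> /le_trans; apply.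
apply: ler_sum => m _; case: ifPn => Nm; last first.
  by rewrite rnorm0 mulr_ge0 ?rnorm_ge0// mulr_ge0 ?invr_ge0 ?(ltW e0)//
    mulrn_wge0// mulr_ge0// exprn_ge0// ltW.
rewrite -[X in rnorm X]mulr_natr rnormM rnorm_nat rnormM !rnormX -[X in _ * (_
  * X)]mulr_natr !mulrA ler_wpM2r//.
case: (nat_of_ord m) Nm (leq_trans N0 Nm) => // k _ _.
rewrite !exprS.
apply: (@le_trans _ _ (e ^+ (n - k.+1) * (rnorm v * e ^+ k))).
  rewrite ler_pM ?mulr_ge0 ?exprn_ge0 ?rnorm_ge0// ?lerXn2r ?nnegrE ?rnorm_ge0
    ?(ltW e0)//.
  by rewrite ler_wpM2l ?rnorm_ge0// lerXn2r ?nnegrE ?rnorm_ge0 ?(ltW e0).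
rewrite le_eqVlt; apply/orP; left; apply/eqP.
by field; rewrite gt_eqF.
Qed.

(** At coordinates of degree below [N] the partial sum is already the whole binomial expansion. At
    the others the tail is at most [A / e * (1 / 2) ^+ N * rnorm (h j)], which sums over [j] because
    the increment [h] lies in [ell_1]. *)
Lemma diagonal_is_taylor (x : E) : is_taylor diagonal x
  (fun m h => to_ell p1 (fun j => diagonal_coef x m j * h j ^+ m)).
Proof.
split=> [m|].
  have [W hW] := l1_diagonal_coef x m.
  by split; [exact: diagonal_homog_poly hW|exact: diagonal_continuous hW].
(* Chosen so that [B * (2 * e) = 1 / 2]. *)
pose e := (4 * B)^-1; have e0 : 0 < e by rewrite invr_gt0 mulr_gt0.
have q0 n : 0 <= A / e * (1 / 2) ^+ n.
  by apply: mulr_ge0; rewrite ?divr_ge0 ?(ltW e0)//; apply: exprn_ge0; lra.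
exists e%:C%C; first by rewrite ltcR0.
have [J hJ] := l1_cvg0 (l1_rnorm x) e0.
apply/uniform_cvgP => b b0; have b0' := Re_gt0 b0.
near=> N => y /ball_rnorm; rewrite ltcR0 => /(_ e0) /=.
rewrite rnormB => ye.
have N_gt0 : (0 < N)%N by near: N; exists 1%N.
(* With [N] above the degrees of the first [J] coordinates, a coordinate of degree at least [N] has
   index at least [J], so that [rnorm (x j) <= e] there. *)
have NJ j : (j < J)%N -> (d j < N)%N.
  move=> jJ; apply: (@leq_ltn_trans (\max_(i < J) d i)).
    exact: (@leq_bigmax _ (fun i : 'I_J => d i) (Ordinal jJ)).
  by near: N; exists (\max_(i < J) d i).+1.
have NA : A / e * (1 / 2) ^+ N * e < complex.Re b.
  rewrite mulrAC divfK ?gt_eqF//.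
  near: N.
  have : (fun N => A * (1 / 2) ^+ N : R) @ \oo --> A * 0.
    by apply: cvgMr; apply: cvg_expr; rewrite ger0_norm; lra.
  by rewrite mulr0 => /cvgrPdist_lt /(_ _ b0'); apply: filterS => n;
    rewrite sub0r normrN; apply: le_lt_trans; exact: ler_norm.
rewrite -rnormE; have -> : b = (complex.Re b)%:C%C by rewrite RRe_real//
  gtr0_real.
rewrite ltcR; apply: le_lt_trans NA.
apply: (@le_trans _ _ (A / e * (1 / 2) ^+ N * rnorm (y - x))); last first.
  exact: (ler_wpM2l (q0 N) (ltW ye)).
apply: rnorm_le_l1; apply: l1_bounded_leZ (l1_rnorm _) => // j.
have hyj : rnorm ((y - x) j) <= e by apply: le_trans (rnorm_coord_le _ _) (ltW
  ye).
rewrite ellB ell_sum diagonalE.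
have -> : y j = x j + (y - x) j by rewrite ellB addrC subrK.
pose h := y - x; rewrite -/h; have hj : rnorm (h j) <= e by [].
rewrite exprDn.
pose G m := (x j ^+ (d j - m) * h j ^+ m) *+ 'C(d j, m).
rewrite (eq_bigr (fun m : 'I_N => a j * G m)) => [|m _]; last first.
  apply: etrans (diagonal_coef_polyE x m h j) _.
  by rewrite /diagonal_coef /G -[in RHS]mulr_natl -!mulrA.
rewrite -mulr_sumr -mulrBr rnormM.
have [dN|Nd] := ltnP (d j) N.
  have -> : \sum_(m < N) G m = \sum_(m < (d j).+1) G m.
    rewrite (big_ord_widen _ _ dN) [RHS]big_mkcond /=.
    by apply: eq_bigr => m _; case: ltnP => // dm; rewrite /G bin_small.
  by rewrite subrr rnorm0 mulr0 mulr_ge0 ?rnorm_ge0.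
have xj : rnorm (x j) <= e.
  by apply: hJ; rewrite leqNgt; apply/negP => /NJ; rewrite ltnNge Nd.
have -> : \sum_(m < (d j).+1) G m - \sum_(m < N) G m = \sum_(m < (d j).+1 | (N
  <= m)%N) G m.
  rewrite (bigID (fun m : 'I_(d j).+1 =>
    (N <= m)%N)) /= (big_ord_widen _ _ (leqW Nd)).
  by rewrite [X in _ + X - _](eq_bigl (fun m : 'I_(d j).+1 =>
    (m < N)%N)) ?addrK// => m; rewrite -ltnNge.
have := binomial_tail_le (d j) N_gt0 e0 xj hj => hb.
apply: (@le_trans _ _ (A * B ^+ d j * (rnorm (h j) * (e^-1 * (2 * e) ^+ d j)))).
  by rewrite ler_pM ?rnorm_ge0.
have -> : A * B ^+ d j * (rnorm (h j) * (e^-1 * (2 * e) ^+ d j)) =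
    A / e * (1 / 2) ^+ d j * rnorm (h j).
  have -> : (1 / 2) = B * (2 * e) :> R by rewrite /e; field; rewrite gt_eqF.
  rewrite [in RHS]exprMn; move: (B ^+ _) ((2 * e) ^+ _) (rnorm _) e^-1 =>
    b1 b2 b3 b4.
  ring.
rewrite ler_wpM2r ?rnorm_ge0// ler_wpM2l ?divr_ge0 ?(ltW e0)//.
by rewrite ler_wiXn2l ?divr_ge0// ler_pdivrMr ?mul1r ?ler1n.
Unshelve. all: by end_near. Qed.

Lemma diagonal_holomorphic : holomorphic diagonal.
Proof. by move=> x; eexists; exact: diagonal_is_taylor. Qed.

End diagonal_function.

(** * Precompactness of images of balls of [ell_1] *)

Section compact_images.
Context (R : realType).
Local Notation C := R[i].
Local Notation E := (ell (lexx (1 : R))).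
Local Notation seqT := (prod_topology (fun _ : nat => (C^o : topologicalType))).

Lemma near_rnorm (G : normedModType C) (x : G) (e : R) : 0 < e ->
  \forall y \near x, rnorm (x - y) < e.
Proof.
move=> e0; near=> y; apply/(@ball_rnorm _ _ _ _ e%:C%C); first by rewrite ltcR0.
by near: y; apply: nbhsx_ballx; rewrite ltcR0.
Unshelve. all: by end_near. Qed.

Lemma rnorm_real_imag (a b : R) : rnorm (Complex a b) <= `|a| + `|b|.
Proof.
rewrite /rnorm normc_def /= -(ger0_norm (addr_ge0 (normr_ge0 a) (normr_ge0 b))).
rewrite -sqrtr_sqr ler_sqrt ?sqr_ge0// sqrrD -(real_normK (num_real a)).
rewrite -(real_normK (num_real b)) lerD2r lerDl mulrn_wge0// mulr_ge0//.
Qed.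

Lemma normr_Re_Im_le (z : C) : `|complex.Re z| <= rnorm z /\ `|complex.Im z| <=
  rnorm z.
Proof.
case: z => a b; rewrite /rnorm normc_def /= -!sqrtr_sqr.
by split; rewrite ler_wsqrtr// ?lerDl ?lerDr sqr_ge0.
Qed.

(** The disc is a closed subset of a continuous image of the square with side [[- r, r]]. *)
Lemma compact_disc (c : C) (r : R) : compact [set z : C^o | rnorm (z - c) <= r].
Proof.
pose g (x : R * R) : C^o := c + Complex x.1 x.2.
have cg : continuous g.
  move=> x; apply/cvgrPdist_lt => e e0.
  have e2 : 0 < complex.Re e / 2 by rewrite divr_gt0// Re_gt0.
  near=> y; have -> : e = (complex.Re e)%:C%C by rewrite RRe_real// gtr0_real.
  rewrite -rnormE ltcR.
  have -> : g x - g y = Complex (x.1 - y.1) (x.2 - y.2).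
    by rewrite /g opprD addrACA subrr add0r.
  apply: le_lt_trans (rnorm_real_imag _ _) _.
  rewrite [ltRHS]splitr ltrD//; near: y.
    by apply: cvgr_dist_lt => //; exact: cvg_fst.
  by apply: cvgr_dist_lt => //; exact: cvg_snd.
apply: subclosed_compact (_ : compact (g @` (`[- r, r]%classic `*` `[- r,
  r]%classic))) _.
- move=> z zc /=; apply/ler_addgt0Pr => e e0.
  have [y [/= yc zy]] := zc _ (@near_rnorm _ (z : C^o) _ e0).
  have -> : z - c = (z - y) + (y - c) by rewrite addrA subrK.
  by apply: le_trans (ler_rnormD _ _) _; rewrite addrC lerD// ltW.
- apply: continuous_compact; first exact: continuous_subspaceT.
  by apply: compact_setX; exact: segment_compact.
move=> z /= zc; have [h1 h2] := normr_Re_Im_le (z - c).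
exists (complex.Re (z - c), complex.Im (z - c)) => /=.
  by split; rewrite /= in_itv /= -ler_norml; apply: le_trans zc.
rewrite /g /=; case: (z - c) (subrK c z) => a b /= <-; exact: addrC.
Unshelve. all: by end_near. Qed.

Lemma near_coordinates (s : seqT) N (d : R) : 0 < d ->
  \forall t \near s, forall i : 'I_N, rnorm (s i - (t : nat -> C) i) < d.
Proof.
move=> d0.
apply: (@filter_forall seqT 'I_N (fun i t => rnorm (s i - (t : nat -> C) i) < d)
  (nbhs s) (nbhs_filter s)) => i.
exact: (@proj_continuous nat (fun=> (C^o : topologicalType)) i s _
  (near_rnorm (s i : C^o) d0)).
Qed.

Definition l1_disc (x0 : E) (e : R) : set seqT :=
  [set s | l1_bounded (fun j => s j - x0 j) e].

(** It lies in a product of discs and is closed there, because each defining inequality involves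
    finitely many coordinates. *)
Lemma l1_disc_compact (x0 : E) (e : R) : compact (l1_disc x0 e).
Proof.
apply: subclosed_compact (@tychonoff _ _ (fun j =>
  [set z : C^o | rnorm (z - x0 j) <= e]) _) _.
- move=> s cs N; apply/ler_addgt0Pr => b b0.
  (* The [N] coordinate errors add up to at most [b]; the successor covers [N = 0]. *)
  have d0 : 0 < b / N.+1%:R by rewrite divr_gt0.
  have [t [tK st]] := cs _ (near_coordinates s N d0).
  apply: (@le_trans _ _ (\sum_(i < N) (rnorm (t i - x0 i) + b / N.+1%:R))).
    apply: ler_sum => i _; have -> : s i - x0 i = (t i - x0 i) + (s i - t i).
      by rewrite [RHS]addrC addrA subrK.
    by apply: le_trans (ler_rnormD _ _) _; rewrite lerD2l ltW.
  rewrite big_split /= lerD ?tK// sumr_const card_ord -[leLHS]mulr_natr.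
  by rewrite mulrAC ler_pdivrMr// ler_pM2l// ler_nat.
- by move=> j; exact: compact_disc.
- by move=> s sK j /=; exact: (@l1_bounded_coord _ (fun j => s j - x0 j)).
Qed.

Lemma l1_disc_bounded (x0 : E) (e : R) (s : seqT) : l1_disc x0 e s ->
  l1_bounded (s : nat -> C) (rnorm x0 + e).
Proof.
move=> sK N; apply: le_trans (lerD (l1_rnorm x0 N) (sK N)).
rewrite -big_split; apply: ler_sum => i _ /=.
by have {1}-> : s i = x0 i + (s i - x0 i) by [rewrite addrC subrK];
  exact: ler_rnormD.
Qed.

(* By Tychonoff, bounded balls of [ell_1] sit in a set that is compact for
   coordinatewise convergence. *)
Lemma precompact_image_l1_ball (F : normedModType C) (f : E -> F) (x0 : E) (e :
  R) :
  0 < e ->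
  (forall b : R, 0 < b -> exists N, exists2 d : R, 0 < d &
    forall x y : E, rnorm (x - x0) <= e -> rnorm (y - x0) <= e ->
    (forall i : 'I_N, rnorm (x i - y i) < d) -> rnorm (f x - f y) < b) ->
  precompact (f @` ball x0 e%:C%C).
Proof.
move=> e0 hf; pose phi (s : seqT) : F := f (to_ell (lexx (1 : R)) s).
have inE (s : seqT) : l1_disc x0 e s ->
    to_ell (lexx (1 : R)) s = s :> (nat -> C) /\
    rnorm (to_ell (lexx (1 : R)) s - x0) <= e.
  move=> sK; have sE := to_ellE (lexx 1) (l1_disc_bounded sK).
  by split=> //; apply: rnorm_le_l1 => N; under eq_bigr do rewrite ellB sE;
    exact: sK.
have cphi : {within l1_disc x0 e, continuous phi}.
  apply/subspace_continuousP => s sK; apply/cvgrPdist_lt => b b0.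
  have [N [d d0 hN]] := hf _ (Re_gt0 b0).
  have [sE se] := inE _ sK.
  rewrite near_withinE; apply: (@filterS _ _ (nbhs_filter s) _ _ _
    (near_coordinates s N d0)) => t st tK.
  have [tE te] := inE _ tK.
  have -> : b = (complex.Re b)%:C%C by rewrite RRe_real// gtr0_real.
  by rewrite -rnormE ltcR; apply: hN => // i; rewrite sE tE.
have ck := continuous_compact cphi (@l1_disc_compact x0 e).
apply: (@precompact_subset _ _ (phi @` l1_disc x0 e)); last first.
  rewrite precompact_closed; first exact: ck.
  by apply: compact_closed ck; exact: norm_hausdorff.
move=> _ [x /ball_rnorm xe <-]; have {xe} := xe (etrans (ltcR0 _) e0).
rewrite /= rnormB => xe; exists (x : nat -> C).
  by move=> N; apply: le_trans (ltW xe); exact: (l1_rnorm (x - x0)).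
by rewrite /phi; congr f; apply: ell_ext => j;
  rewrite (to_ellE (lexx 1) (l1_rnorm x)).
Qed.

End compact_images.

(** * Compactness of diagonal maps *)

Section diagonal_compact.
Context (R : realType) (p : R) (p1 : 1 <= p).
Local Notation C := R[i].
Local Notation E := (ell (lexx (1 : R))).
Local Notation F := (ell p1).
Context (a : nat -> C) (d : nat -> nat) (A B : R).
Hypothesis B0 : 0 < B.
Hypothesis d_gt0 : forall j, (0 < d j)%N.
Hypothesis d_oo : forall m, exists J, forall j, (J <= j)%N -> (m <= d j)%N.
Hypothesis aAB : forall j, rnorm (a j) <= A * B ^+ d j.

Let A0 : 0 <= A.
Proof.
by have := le_trans (rnorm_ge0 _) (aAB 0); rewrite pmulr_lge0// exprn_gt0.
Qed.

(** One factor [z] is kept for summation over [j]; the other [d j - 1] factors, set against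
    [B ^+ d j], leave a geometric decay in the degree. *)
Lemma diagonal_coord_le (z : C) j m : rnorm z <= (2 * B)^-1 -> (m <= d j)%N ->
  rnorm (a j * z ^+ d j) <= 2 * A * B * (1 / 2) ^+ m * rnorm z.
Proof.
move=> zB mj; rewrite rnormM rnormX.
have b2 : 2 * B != 0 by rewrite mulf_neq0// gt_eqF.
apply: (@le_trans _ _ (A * B ^+ d j * (rnorm z * (2 * B)^-1 ^+ (d j).-1))).
  rewrite ler_pM ?exprn_ge0 ?rnorm_ge0//.
  rewrite -{1}(prednK (d_gt0 j)) exprS ler_wpM2l ?rnorm_ge0//.
  by rewrite lerXn2r ?nnegrE ?rnorm_ge0// invr_ge0 mulr_ge0 ?(ltW B0).
have -> : A * B ^+ d j * (rnorm z * (2 * B)^-1 ^+ (d j).-1) =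
    2 * A * B * (1 / 2) ^+ d j * rnorm z.
  have {1 3}-> : d j = (d j).-1.+1 by rewrite prednK.
  move: (d j).-1 (rnorm z) => k r.
  have -> : (1 / 2) = B * (2 * B)^-1 :> R.
    by rewrite invfM mulrCA divff ?gt_eqF// mulr1 div1r.
  rewrite exprMn !exprS; move: (B ^+ k) ((2 * B)^-1 ^+ k) => u v.
  by field; rewrite gt_eqF.
rewrite ler_wpM2r ?rnorm_ge0// ler_wpM2l ?mulr_ge0 ?(ltW B0)//.
by rewrite ler_wiXn2l ?divr_ge0// ler_pdivrMr ?mul1r ?ler1n.
Qed.

(** On a small ball the coordinates from [J] on are uniformly negligible in [ell_1], since their
    degrees are large, and the first [J] depend on their variables in a Lipschitz way. So closeness
    in [J] coordinates controls the value. *)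
Lemma diagonal_locally_compact : locally_compact_image (diagonal p1 a d).
Proof.
move=> x0; pose e := (4 * B)^-1; have e0 : 0 < e by rewrite invr_gt0 mulr_gt0.
exists e%:C%C; first by rewrite ltcR0.
apply: precompact_image_l1_ball => // b b0.
have [J1 hJ1] := l1_cvg0 (l1_rnorm x0) e0.
pose M := rnorm x0 + e; have M0 : 0 < M by rewrite ltr_wpDl ?rnorm_ge0.
(* The factor [2 * M] bounds the sum of [rnorm (x j) + rnorm (y j)], the sequence against which the
   tail is compared. *)
have [m hm] : exists m, 2 * A * B * (1 / 2) ^+ m * (2 * M) < b / 2.
  have b20 : 0 < b / 2 by rewrite divr_gt0.
  have : (fun m => 2 * A * B * (2 * M) * (1 / 2) ^+ m : R) @ \oo --> 2 * A * B
    * (2 * M) * 0.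
    by apply: cvgMr; apply: cvg_expr;
      rewrite ger0_norm ?divr_ge0// ltr_pdivrMr// mul1r ltr1n.
  rewrite mulr0 => /cvgrPdist_lt /(_ _ b20)[m _ hm]; exists m.
  have := hm m (leqnn _); rewrite /= sub0r normrN mulrAC.
  by apply: le_lt_trans; exact: ler_norm.
have [J2 hJ2] := d_oo m.
pose J := maxn J1 J2; pose r := M + 1.
have r1 : 1 <= r by rewrite lerDr ltW.
(* The sum of the Lipschitz constants of the first [J] coordinates on the ball of radius [r]. *)
pose L := \sum_(i < J) rnorm (a i) * ((d i)%:R * r ^+ d i).
have L0 : 0 <= L.
  apply: sumr_ge0 => i _; rewrite mulr_ge0 ?rnorm_ge0// mulr_ge0// exprn_ge0//.
  exact: le_trans r1.
pose dl := b / 2 / (L + 1); have dl0 : 0 < dl.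
  by rewrite !divr_gt0// ltr_wpDl.
exists J, dl => // x y xe ye xy.
have norm_le (z : E) : rnorm (z - x0) <= e -> rnorm z <= M.
  move=> ze; have -> : z = x0 + (z - x0) by rewrite addrC subrK.
  by apply: le_trans (ler_rnormD _ _) _; rewrite lerD2l.
have small (z : E) j : rnorm (z - x0) <= e -> (J <= j)%N -> rnorm (z j) <= (2 *
  B)^-1.
  move=> ze; rewrite geq_max => /andP[/hJ1 xj _].
  have -> : (2 * B)^-1 = e + e by rewrite /e; field; rewrite gt_eqF.
  have -> : z j = x0 j + (z - x0) j by rewrite ellB addrC subrK.
  apply: le_trans (ler_rnormD _ _) _; rewrite lerD//.
  exact: le_trans (rnorm_coord_le _ _) _.
pose t j : C := (rnorm (x j) + rnorm (y j))%:C%C.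
have tE j : rnorm (t j) = rnorm (x j) + rnorm (y j).
  by rewrite rnorm_C ger0_norm// addr_ge0 ?rnorm_ge0.
have tM : l1_bounded t (2 * M).
  move=> N; under eq_bigr do rewrite tE.
  have -> : 2 * M = M + M by ring.
  by rewrite big_split lerD//;
    [apply: le_trans (l1_rnorm x N) _|apply: le_trans (l1_rnorm y N) _];
      exact: norm_le.
have c0 : 0 <= 2 * A * B * (1 / 2) ^+ m.
  by apply: mulr_ge0; rewrite ?mulr_ge0 ?(ltW B0)// exprn_ge0// divr_ge0.
have fE z j : diagonal p1 a d z j = a j * z j ^+ d j := diagonalE p1 B0 d_oo
  aAB z j.
have := @l1_bounded_eventually _ (diagonal p1 a d x - diagonal p1 a d y) t J _
  _ c0 _ tM.
move=> /(_ _)/rnorm_le_l1 h; apply: le_lt_trans (h _) _ => {h} [j Jj|].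
  rewrite ellB !fE tE mulrDr.
  apply: le_trans (ler_rnormD _ _) _; rewrite rnormN.
  have mj : (m <= d j)%N by apply: hJ2; move: Jj; rewrite geq_max => /andP[].
  by rewrite lerD// diagonal_coord_le// small.
rewrite [ltRHS]splitr ltr_leD// 1?ltW//.
apply: (@le_lt_trans _ _ (L * dl)); last first.
  rewrite /dl mulrC mulrAC ltr_pdivrMr ?ltr_wpDl// ltr_pM2l ?divr_gt0//.
  by rewrite ltrDl.
rewrite /L mulr_suml; apply: ler_sum => i _.
rewrite ellB !fE -mulrBr rnormM -mulrA ler_wpM2l ?rnorm_ge0//.
have xr : rnorm (x i) <= r.
  by apply: le_trans (rnorm_coord_le _ _) _;
    rewrite (le_trans (norm_le _ xe))// lerDl.
have yr : rnorm (y i) <= r.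
  by apply: le_trans (rnorm_coord_le _ _) _;
    rewrite (le_trans (norm_le _ ye))// lerDl.
apply: le_trans (rnorm_expB_le _ r1 xr yr) _.
apply: ler_wpM2l; last exact/ltW/xy.
by rewrite mulr_ge0// exprn_ge0// (le_trans _ r1).
Qed.

End diagonal_compact.

(** * Relative [p]-compactness of diagonal polynomials *)

Section pcompact.
Context (R : realType) (p : R) (p1 : 1 <= p).
Local Notation C := R[i].
Local Notation E := (ell (lexx (1 : R))).
Local Notation F := (ell p1).

Let p_gt0 : 0 < p. Proof. exact: lt_le_trans p1. Qed.

Let conj_ge1 : (1 <= hoelder_conjugate p%:E)%E.
Proof. by apply: hoelder_conj_ge1; rewrite lee_fin. Qed.

Lemma ell_powR_sum_lty (x : F) : (\sum_(0 <= k <oo) (rnorm (x k) `^ p)%:E <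
  +oo)%E.
Proof.
apply: (@lty_poweRy _ _ p^-1); first by rewrite invr_neq0// gt_eqF.
by rewrite -ell_normE// -rnorm_ellE ltry.
Qed.

Lemma ell_powR_sum (x : F) :
  (\sum_(0 <= k <oo) (rnorm (x k) `^ p)%:E = (rnorm x `^ p)%:E)%E.
Proof.
rewrite -poweR_EFin rnorm_ellE ell_normE// -poweRrM mulVf ?gt_eqF// poweRe1//.
by apply: nneseries_ge0 => *; rewrite lee_fin powR_ge0.
Qed.

Lemma l1_series_delta (y : nat -> C) M : l1_bounded y M ->
  series (fun n => delta p1 (y n) n) @ \oo --> to_ell p1 y.
Proof.
move=> yM; apply/cvgrPdist_lt => e e0;
  have e2 := divr_gt0 (Re_gt0 e0) (ltr0Sn R 1).
have [J hJ] := l1_tail yM e2; exists J => // N JN /=.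
have -> : e = (complex.Re e)%:C%C by rewrite RRe_real// gtr0_real.
rewrite -rnormE ltcR.
apply: (@le_lt_trans _ _ (complex.Re e / 2)); last first.
  by rewrite ltr_pdivrMr// ltr_pMr ?Re_gt0// ltr1n.
apply: rnorm_le_l1 => K; apply: le_trans (hJ K).
rewrite [leRHS]big_mkcond; apply: ler_sum => i _.
rewrite ellB (to_ellE p1 yM) /series /= big_mkord ell_sum.
under eq_bigr do rewrite deltaE.
have [iN|Ni] := ltnP i N.
  rewrite (bigD1 (Ordinal iN)) //= eqxx big1 ?addr0 => [|k ki]; last first.
    have : nat_of_ord i != k by rewrite eq_sym; apply: contra ki => /eqP ki;
      apply/eqP/val_inj.
    by move/negbTE ->.
  by rewrite subrr rnorm0; case: ifP => // _; exact: rnorm_ge0.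
rewrite big1 ?subr0 => [|k _]; last first.
  by have /negbTE -> : nat_of_ord i != k by rewrite neq_ltn (leq_trans (ltn_ord
    k) Ni) orbT.
by rewrite (leq_trans JN Ni).
Qed.

(** Coefficient sequences must have norm strictly below 1, hence the representation of [y] as one
    half of [2 *: y]. This covers the constant Taylor terms. *)
Lemma relatively_pcompact_set1 (y : F) : relatively_pcompact p [set y].
Proof.
exists (fun n => (2 *: y) *+ (n == 0%N)).
  rewrite (nneseries_split 0 1) => [|k _]; last by rewrite lee_fin powR_ge0.
  rewrite big_nat1.
  rewrite eseries0 => [|k k1 _]; last first.
    by rewrite gtn_eqF ?mulr0n ?rnorm0 ?powR0 ?gt_eqF.
  by rewrite adde0 ltry.
move=> _ ->; exists (fun n => (1 / 2) *+ (n == 0%N)).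
  apply: le_lt_trans (ell_norm_le_l1 conj_ge1 (l1_delta (1 / 2) 0)) _.
  have -> : (1 / 2 : C) = (1 / 2 : R)%:C%C by rewrite !div1r fmorphV rmorph_nat.
  by rewrite rnorm_C lte_fin ger0_norm ?divr_ge0// ltr_pdivrMr// mul1r ltr1n.
apply: cvg_near_cst; exists 1%N => // N /= N1.
rewrite /series /= big_ltn// big_nat big1 ?addr0 => [|k /andP[k1 _]];
  last first.
  by rewrite gtn_eqF// !mulr0n scaler0.
by rewrite !mulr1n scalerA divrK ?scale1r// unitfE pnatr_eq0.
Qed.

(** The generating sequence consists of the multiples [2 * w n] of the unit vectors, [p]-summable
    because [w] is in [ell_1]. In positive degree the coefficients are dominated by
    [1 / 2 * rnorm (h n)], so they have norm below 1 in [ell_1], hence in the conjugate space. *)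
Lemma diagonal_poly_pcompact (w : nat -> C) W m : l1_bounded w W ->
  relatively_pcompact p
    ((fun h : E => to_ell p1 (fun j => w j * h j ^+ m)) @` ball 0 1).
Proof.
move=> wW; case: m => [|m].
  have [x xs hx] := relatively_pcompact_set1 (to_ell p1 w).
  exists x => // _ [h _ <-]; apply: hx => /=; congr to_ell.
  by apply/funext => j; rewrite expr0 mulr1.
have w2 : l1_bounded (fun j => 2 * w j) (2 * W).
  by apply: l1_bounded_leZ wW => // k; rewrite rnormM rnorm_nat.
exists (fun n => delta p1 (2 * w n) n).
  have := ell_powR_sum_lty (to_ell p1 (fun j => 2 * w j)).
  rewrite (to_ellE p1 w2); congr (_ < _)%E; apply: eq_eseriesr => k _.
  by rewrite rnorm_delta.
move=> _ [h /ball_rnorm h1 <-]; have {h1} := h1 ltr01.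
rewrite sub0r rnormN => h1; have {}h1 : rnorm h < 1 := h1.
have half : rnorm (1 / 2 : C) = 1 / 2.
  have -> : (1 / 2 : C) = (1 / 2 : R)%:C%C by rewrite !div1r fmorphV rmorph_nat.
  by rewrite rnorm_C ger0_norm// divr_ge0.
exists (fun n => 1 / 2 * h n ^+ m.+1).
  have hb : l1_bounded (fun n => 1 / 2 * h n ^+ m.+1) (1 / 2 * rnorm h).
    apply: l1_bounded_leZ (l1_rnorm h) => [|k]; first by rewrite divr_ge0.
    rewrite rnormM half ler_wpM2l ?divr_ge0// rnormX exprS ler_piMr
      ?rnorm_ge0//.
    by rewrite exprn_ile1 ?rnorm_ge0// (le_trans (rnorm_coord_le _ _))// ltW.
  apply: le_lt_trans (ell_norm_le_l1 conj_ge1 hb) _.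
  by rewrite lte_fin; have := rnorm_ge0 h; lra.
rewrite [X in series X](_ : _ = fun n => delta p1 (w n * h n ^+ m.+1) n).
  exact: l1_series_delta (l1_pow m.+1 wW h).
apply/funext => n; apply: ell_ext => j.
rewrite ellZ !deltaE; case: eqP => _; rewrite ?mulr0n ?mulr0// !mulr1n.
by rewrite mulrACA divfK ?pnatr_eq0// mul1r mulrC.
Qed.

End pcompact.

(** * A necessary condition for relative [p]-compactness *)

Section not_pcompact.
Context (R : realType) (p : R) (p1 : 1 <= p).
Local Notation C := R[i].
Local Notation E := (ell (lexx (1 : R))).
Local Notation F := (ell p1).

Let p_gt0 : 0 < p. Proof. exact: lt_le_trans p1. Qed.

Lemma hoelder_partial_sum (al z : nat -> C) N :
  (ell_norm (hoelder_conjugate p%:E) al < 1)%E ->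
  ((\sum_(n < N) rnorm (al n * z n))%:E <= ell_norm p%:E z)%E.
Proof.
move=> al1; have conj_ge1 : (1 <= hoelder_conjugate p%:E)%E.
  by apply: hoelder_conj_ge1; rewrite lee_fin.
(* For [p = 1] the conjugate exponent is infinite, and the coefficients are simply bounded by 1. *)
have [p1E|p_neq1] := eqVneq p 1.
  have al1n n : rnorm (al n) <= 1.
    rewrite -lee_fin; apply: le_trans (ell_norm_coord_le al n conj_ge1) _.
    exact: ltW.
  rewrite p1E ell_normE// invr1 poweRe1; last first.
    by apply: nneseries_ge0 => *; rewrite lee_fin powR_ge0.
  apply: le_trans (nneseries_lim_ge N _); last by move=> *;
    rewrite lee_fin powR_ge0.
  rewrite big_mkord sumEFin lee_fin; apply: ler_sum => n _.
  by rewrite powRr1 ?rnorm_ge0// rnormM ler_piMl ?rnorm_ge0.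
have p_gt1 : 1 < p by rewrite lt_neqAle eq_sym p_neq1.
pose q := p / (p - 1); have p1' : 0 < p - 1 by rewrite subr_gt0.
have q0 : 0 < q by rewrite divr_gt0.
have qE : hoelder_conjugate p%:E = q%:E.
  rewrite /hoelder_conjugate/= eqe gt_eqF// inver subr_eq0 gt_eqF//.
have pq : q^-1 + p^-1 = 1 by rewrite /q invf_div; field;
  rewrite gt_eqF//= gt_eqF.
have := @hoelder _ _ R (@counting nat R) (fun n => rnorm (al n)) (fun n =>
  rnorm (z n)) q p.
move=> /(_ _ _ q0 p_gt0 pq) h.
have {h} := h _ _ => /(_ ltac:(by []) ltac:(by [])) h.
apply: le_trans (_ : 'N[counting]_1 [EFin \o (fun n =>
  rnorm (al n) * rnorm (z n))%R] <= _)%E.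
  rewrite Lnorm_counting// invr1 poweRe1; last first.
    by apply: nneseries_ge0 => *; rewrite poweR_ge0.
  apply: le_trans (nneseries_lim_ge N _); last by move=> *; rewrite poweR_ge0.
  rewrite big_mkord -sumEFin; apply: lee_sum => n _ /=.
  by rewrite powRr1 ?normr_ge0// rnormM ger0_norm// mulr_ge0 ?rnorm_ge0.
apply: le_trans h _; rewrite -/(ell_norm q%:E al) -/(ell_norm p%:E z) -qE.
by rewrite -[leRHS]mul1e lee_wpmul2r ?ell_norm_ge0// ltW.
Qed.

(** By Hoelder, the [j]-th coordinate of any member of [S] is at most the [ell_p] norm of the column
    [n |-> x n j]. Summing [p]-th powers over [j] and exchanging the sums leaves the total of the
    [rnorm (x n) ^ p], whichever member is picked for each [j]. *)
Lemma relatively_pcompact_diag (S : set F) : relatively_pcompact p S ->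
  exists X : R, forall (y : nat -> F) N, (forall j, S (y j)) ->
    \sum_(j < N) rnorm (y j j) `^ p <= X.
Proof.
move=> [x xs Sx].
have pos u : (0 <= (rnorm u `^ p : R)%:E)%E by rewrite lee_fin powR_ge0.
pose X := (\sum_(0 <= n <oo) (rnorm (x n) `^ p)%:E)%E.
have X0 : (0 <= X)%E by apply: nneseries_ge0.
exists (fine X) => y N Sy.
rewrite -lee_fin fineK ?ge0_fin_numE// -sumEFin.
have key j : ((rnorm (y j j) `^ p)%:E <= \sum_(0 <= n <oo) (rnorm (x n j) `^
  p)%:E)%E.
  have [al al1 /cvgrPdist_lt hy] := Sx _ (Sy j).
  have h : ((rnorm (y j j))%:E <= ell_norm p%:E (fun n => x n j))%E.
    (* Replacing [y j] by a partial sum of its series costs at most [e] in the [j]-th coordinate. *)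
    apply/lee_addgt0Pr => e e0.
    have [M _ hM] := hy e%:C%C (etrans (ltcR0 _) e0).
    have := hM M (leqnn _); rewrite -rnormE ltcR => hMe.
    have hH := hoelder_partial_sum (fun n => x n j) M al1.
    apply: le_trans (leeD hH (lexx e%:E)); rewrite -EFinD lee_fin.
    have -> : y j j = \sum_(n < M) al n * x n j + (y j - series (fun n =>
      al n *: x n) M) j.
      rewrite ellB /series /= big_mkord ell_sum.
      by under [X in _ - X]eq_bigr do rewrite ellZ; rewrite addrC subrK.
    apply: le_trans (ler_rnormD _ _) (lerD (ler_rnorm_sum _) _).
    exact: le_trans (rnorm_coord_le _ _) (ltW hMe).
  rewrite -poweR_EFin.
  apply: le_trans (_ : (ell_norm p%:E (fun n => x n j) `^ p <= _)%E).
    apply: gt0_ler_poweR => //; first exact: ltW.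
      by rewrite in_itv/= leey andbT lee_fin rnorm_ge0.
    by rewrite in_itv/= leey andbT ell_norm_ge0.
  rewrite (ell_normE p1) -poweRrM mulVf ?gt_eqF// poweRe1//.
  by apply: nneseries_ge0 => n _ _; exact: pos.
apply: le_trans (lee_sum _ (fun j _ => key (nat_of_ord j))) _.
rewrite -nneseries_sum//.
apply: lee_nneseries => [n _ _|n _]; first by apply: sume_ge0.
rewrite -ell_powR_sum.
apply: le_trans (nneseries_lim_ge N _); last by [].
by rewrite big_mkord.
Qed.

Lemma inj_sum_le (G : nat -> R) M N (g : 'I_M -> nat) : (forall j, 0 <= G j) ->
  injective g -> (forall i, (g i < N)%N) ->
  \sum_(i < M) G (g i) <= \sum_(j < N) G j.
Proof.
move=> G0 gI gN; pose h i := Ordinal (gN i).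
have hI : {in [set: 'I_M]%SET &, injective h} by move=> i j _ _ [/gI].
have -> : \sum_(i < M) G (g i) = \sum_(j in h @: [set: 'I_M]%SET) G j.
  by rewrite big_imset//=; apply: eq_bigl => i; rewrite finset.in_setT.
rewrite [leLHS]big_mkcond; apply: ler_sum => j _.
by case: ifP => // _; exact: G0.
Qed.

End not_pcompact.

(** * Enumeration of the coordinates by degree and class *)

(* Degree [n] is attained at [n ^ n] coordinates of each class [k < n]. *)
Definition block_index : Type := {n : nat & ('I_n * 'I_(n ^ n))%type}.

(** The default [j.+1], outside the range of [pickle], keeps degrees positive and tending to
    infinity. *)
Definition degree (j : nat) : nat :=
  if @pickle_inv block_index j is Some t then tag t else j.+1.

Definition class (j : nat) : nat :=
  if @pickle_inv block_index j is Some t then (tagged t).1 else 0.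

Lemma degree_gt0 j : (0 < degree j)%N.
Proof.
rewrite /degree; case: pickle_inv => // -[n [i _]] /=.
exact: leq_ltn_trans (ltn_ord i).
Qed.

Lemma degree_oo m : exists J, forall j, (J <= j)%N -> (m <= degree j)%N.
Proof.
pose M n := \max_(u : 'I_n * 'I_(n ^ n)) pickle (existT _ n u : block_index).
(* The maximum bounds the codes of all block elements of degree below [m]; the summand [m] takes
   care of the default degrees. *)
exists (m + (\max_(n < m) M n).+1)%N => j Jj.
rewrite /degree; case E : pickle_inv => [[n u]|] /=; last first.
  by rewrite ltnW// ltnS (leq_trans (leq_addr _ _) Jj).
rewrite leqNgt; apply/negP => nm.
have jE : pickle (existT _ n u : block_index) = j.
  by have := @pickle_invK block_index j; rewrite E.
have : (j <= \max_(n < m) M n)%N.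
  apply: (leq_trans _ (@leq_bigmax _ (fun n : 'I_m => M n) (Ordinal nm))).
  by rewrite -jE; exact: (@leq_bigmax ('I_n * 'I_(n ^ n))%type
    (fun u => pickle (existT _ n u : block_index)) u).
by rewrite leqNgt (leq_trans _ Jj)// addnS ltnS leq_addl.
Qed.

Lemma block_embedding k n : (k < n)%N -> exists g : 'I_(n ^ n) -> nat,
  [/\ injective g, forall i, degree (g i) = n & forall i, class (g i) = k].
Proof.
move=> kn; exists (fun i => pickle (existT _ n (Ordinal kn, i) : block_index)).
split=> [i i' /(pcan_inj pickleK) /eqP|i|i]; last 2 first.
- by rewrite /degree pickleK_inv.
- by rewrite /class pickleK_inv.
by rewrite eq_Tagged /= => /eqP[].
Qed.

Lemma class_surj k : exists j, class j = k.
Proof.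
have [g [_ _ gk]] := block_embedding (ltnSn k).
have n0 : (0 < k.+1 ^ k.+1)%N by rewrite expn_gt0.
by exists (g (Ordinal n0)).
Qed.

(** * Diagonal maps whose coefficients depend only on the class *)

Section diagonal_space.
Context (R : realType) (p : R) (p1 : 1 <= p).
Local Notation C := R[i].
Local Notation E := (ell (lexx (1 : R))).
Local Notation F := (ell p1).

(** Near [x0] the map is within 1 of one partial sum, and that sum is continuous, so it stays within
    1 of its value at the centre. *)
Lemma is_taylor_bounded (G H : normedModType C) (f : G -> H) x0 P :
  is_taylor f x0 P -> exists r M : R, [/\ 0 < r, 0 <= M &
    forall x, rnorm (x - x0) < r -> rnorm (f x) <= M].
Proof.
move=> fP; have [r0 r00 cvf] := is_taylor_cvg fP.
have [N hN] := cvf 1 ltr01.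
have cS n : continuous (fun y => \sum_(k < n) P k y).
  elim: n => [|n IH].
    rewrite (_ : (fun y => _) = cst 0); first exact: cst_continuous.
    by apply/funext => y; rewrite big_ord0.
  rewrite (_ : (fun y => _) = (fun y => \sum_(k < n) P k y) + P n); last first.
    by apply/funext => y; rewrite big_ord_recr.
  by move=> y; apply: cvgD; [exact: IH|exact: (fP.1 n).2].
have /cvgrPdist_lt/(_ 1 ltr01)/nbhs_ballP[e /= e0 he] := cS N 0.
set S0 := \sum_(n < N) P n 0 in he.
exists (Num.min r0 (complex.Re e)), (1 + (rnorm S0 + 1)); split.
- by rewrite lt_min r00 Re_gt0.
- by rewrite addr_ge0// addr_ge0// rnorm_ge0.
move=> x; rewrite lt_min => /andP[xr xe].
have -> : f x = (f x - \sum_(n < N) P n (x - x0)) + \sum_(n < N) P n (x - x0).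
  by rewrite subrK.
apply: le_trans (ler_rnormD _ _) (lerD (ltW (hN N x (leqnn _) xr)) _).
have /= : `|S0 - \sum_(n < N) P n (x - x0)| < 1.
  by apply: he; apply/(ball_rnorm _ _ e0); rewrite sub0r rnormN.
have -> : 1 = (1 : R)%:C%C :> C by [].
rewrite -rnormE ltcR => hS.
move: (\sum_(n < N) _) hS => S hS.
have -> : S = S0 - (S0 - S) by rewrite opprB addrC subrK.
by apply: le_trans (ler_rnormD _ _) _; rewrite lerD2l rnormN ltW.
Qed.

(** No growth of [c] is prescribed: it follows from holomorphy, by [class_coef_growth]. *)
Definition class_diagonal (f : E -> F) (c : nat -> C) : Prop :=
  forall x j, f x j = c (class j) * x j ^+ degree j.

(** Evaluation at [s] times the [j]-th unit vector, inside a ball where [f] is bounded by [M], gives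
    a Cauchy estimate with [B = s^-1]. The formula is assumed only near 0, which is all that is
    known of a limit before the identity theorem applies. *)
Lemma class_coef_growth (f : E -> F) (c : nat -> C) (e : R) : holomorphic f ->
  0 < e ->
  (forall x, rnorm x < e -> forall j, f x j = c (class j) * x j ^+ degree j) ->
  exists A B : R, 0 < B /\
    forall j, rnorm (c (class j)) <= A * B ^+ degree j.
Proof.
move=> hf e0 fc; have [r [M [r0 M0 hM]]] := is_taylor_bounded (taylorP 0 hf).
pose s := Num.min e r / 2.
have m0 : 0 < Num.min e r by rewrite lt_min e0.
have s0 : 0 < s by rewrite divr_gt0.
have : s < Num.min e r by rewrite ltr_pdivrMr// ltr_pMr// ltr1n.
rewrite lt_min => /andP[se sr].
exists M, s^-1; split=> [|j]; first by rewrite invr_gt0.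
rewrite exprVn ler_pdivlMr ?exprn_gt0//.
have sn : rnorm (delta (lexx (1 : R)) s%:C%C j) = s.
  by rewrite rnorm_delta rnorm_C ger0_norm// ltW.
have := rnorm_coord_le (f (delta (lexx (1 : R)) s%:C%C j)) j.
rewrite fc ?sn// rnormM rnormX deltaE eqxx mulr1n rnorm_C ger0_norm ?(ltW s0)//.
by move=> /le_trans; apply; apply: hM; rewrite subr0 sn.
Qed.

Lemma class_diagonalE f c A B : 0 < B ->
  (forall j, rnorm (c (class j)) <= A * B ^+ degree j) -> class_diagonal f c ->
  f = diagonal p1 (c \o class) degree.
Proof.
move=> B0 cAB fc; apply/funext => x; apply: ell_ext => j.
by rewrite fc (diagonalE p1 B0 degree_oo cAB).
Qed.

Lemma class_diagonal_taylor f c x0 : holomorphic f -> class_diagonal f c ->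
  forall m, exists W, l1_bounded (diagonal_coef (c \o class) degree x0 m) W /\
    taylor f x0 m =
      (fun h => to_ell p1 (fun j =>
        diagonal_coef (c \o class) degree x0 m j * h j ^+ m)).
Proof.
move=> hf fc m.
have [A [B [B0 cAB]]] := class_coef_growth hf ltr01 (fun x _ => fc x).
have [W hW] := l1_diagonal_coef B0 degree_oo cAB x0 m; exists W; split => //.
rewrite (taylorE (P := fun m (h : E) => to_ell p1
  (fun j => diagonal_coef (c \o class) degree x0 m j * h j ^+ m)))//.
rewrite (class_diagonalE B0 cAB fc).
exact: (diagonal_is_taylor p1 B0 degree_oo cAB x0).
Qed.

Lemma class_diagonal_taylor0 f c m (h : E) j : holomorphic f ->
  class_diagonal f c ->
  taylor f 0 m h j = (c (class j) * h j ^+ m) *+ (degree j == m).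
Proof.
move=> hf fc; have [W [hW ->]] := class_diagonal_taylor 0 hf fc m.
rewrite (to_ellE p1 (l1_pow m hW h)) /diagonal_coef /=.
rewrite [X in X ^+ (_ - _)](_ : _ = 0)//.
have [<-|dm] := eqVneq (degree j) m;
  first by rewrite subnn binn expr0 mulr1 mulr1.
(* Here truncated subtraction yields the power [0 ^+ 0], and the binomial coefficient is what
   vanishes. *)
have [dm'|md] := ltnP (degree j) m;
  first by rewrite bin_small// mul0r mulr0 mul0r.
by rewrite expr0n subn_eq0 leqNgt ltn_neqAle eq_sym dm md /= !mulr0 mul0r.
Qed.

Lemma class_diagonal_pcompact f c : holomorphic f -> class_diagonal f c ->
  pcompact_taylor p f.
Proof.
move=> hf fc x0 m; have [W [hW ->]] := class_diagonal_taylor x0 hf fc m.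
exact: diagonal_poly_pcompact.
Qed.

Lemma class_diagonal_not_pcompact f c k : class_diagonal f c -> c k != 0 ->
  ~ locally_pcompact_image p f.
Proof.
move=> fc ck /(_ 0)[e e0 /relatively_pcompact_diag[X hX]].
pose s := complex.Re e / 2; have s0 : 0 < s by rewrite divr_gt0// Re_gt0.
pose y j := f (delta (lexx (1 : R)) s%:C%C j).
have ye j : (f @` ball 0 e) (y j).
  exists (delta (lexx (1 : R)) s%:C%C j) => //; apply/ball_rnorm => //.
  rewrite sub0r rnormN rnorm_delta rnorm_C ger0_norm ?(ltW s0)//.
  by rewrite ltr_pdivrMr// ltr_pMr ?Re_gt0// ltr1n.
have {}hX N := hX y N ye.
have yE j : rnorm (y j j) = rnorm (c (class j)) * s ^+ degree j.
  by rewrite fc deltaE eqxx mulr1n rnormM rnormX rnorm_C ger0_norm// ltW.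
have p0 : 0 < p by exact: lt_le_trans p1.
pose q := s `^ p; have q0 : 0 < q by rewrite powR_gt0.
pose g := rnorm (c k) `^ p.
have g0 : 0 < g.
  rewrite powR_gt0// lt_neqAle rnorm_ge0 andbT eq_sym.
  by apply: contra ck => /eqP /rnorm0_eq0 ->.
(* The block of degree [n] and class [k] has [n ^ n] coordinates, each contributing [g * q ^+ n]. *)
have bound n : (k < n)%N -> (n%:R * q) ^+ n * g <= X.
  move=> /block_embedding[h [hI hd hk]].
  pose N := (\max_i h i).+1.
  apply: le_trans (hX N).
  have hN i : (h i < N)%N by rewrite ltnS (leq_bigmax (F := h)).
  have := @inj_sum_le _ (fun j => rnorm (y j j) `^ p) _ N h (fun j =>
    powR_ge0 _ _) hI hN.
  apply: le_trans; rewrite (eq_bigr (fun=> g * q ^+ n)) => [|i _]; last first.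
    rewrite yE hd hk powRM ?rnorm_ge0 ?exprn_ge0 ?(ltW s0)//; congr (_ * _).
    by rewrite -powR_mulrn ?(ltW s0)// -powRrM mulrC powRrM powR_mulrn//
      powR_ge0.
  by rewrite sumr_const card_ord -[leRHS]mulr_natr natrX exprMn mulrC mulrCA
    mulrC.
have [n1 hn1] : exists n : nat, 2 / q <= n%:R.
  by exists (Num.truncn (2 / q)).+1; rewrite ltW// truncnS_gt.
have [n2 hn2] : exists n : nat, X / g < n%:R.
  by exists (Num.truncn (X / g)).+1; rewrite truncnS_gt.
(* The three summands ensure that class [k] occurs in degree [n], that [2 <= n * q], and that
   [X / g < n <= 2 ^ n <= (n * q) ^ n]. *)
pose n := (k.+1 + n1 + n2)%N.
have kn : (k < n)%N by rewrite /n; apply: (@leq_trans (k.+1 + n1));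
  rewrite leq_addr.
have := bound n kn; rewrite leNgt => /negP; apply.
move: hn2; rewrite ltr_pdivrMr// => /lt_le_trans; apply.
rewrite ler_pM2r//; apply: (@le_trans _ _ (n%:R)).
  by rewrite ler_nat leq_addl.
apply: (@le_trans _ _ (2 ^+ n)).
  by rewrite -natrX ler_nat ltnW// ltn_expl.
rewrite lerXn2r ?nnegrE ?mulr_ge0 ?(ltW q0)// -ler_pdivrMr//.
by apply: le_trans hn1 _; rewrite ler_nat /n addnAC leq_addl.
Qed.

End diagonal_space.

(** * Taylor coefficients at 0 under the Nachbin topology *)

Section nachbin.
Context (R : realType) (E F : normedModType R[i]).
Local Notation C := R[i].
Implicit Types f g : cholo E F.

Lemma cholo_holomorphic f : holomorphic f.
Proof. by have := cholo_funP f; rewrite inE => -[]. Qed.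

Lemma choloD f g x : (f + g) x = f x + g x.
Proof. by []. Qed.

Lemma choloZ (a : C) f x : (a *: f) x = a *: f x.
Proof. by []. Qed.

Lemma cholo0 x : (0 : cholo E F) x = 0.
Proof. by []. Qed.

Lemma cholo_sum n (f : 'I_n -> cholo E F) x :
  (\sum_(i < n) f i) x = \sum_(i < n) f i x.
Proof.
elim/big_rec2: _ => [|i y g _ <-]; first exact: cholo0.
by rewrite choloD.
Qed.

(** The balanced hull of a point. With the zero sequence, its Nachbin seminorm dominates the norm at
    [x] of every Taylor polynomial at 0. *)
Definition disc_line (x : E) : set E :=
  [set l *: x | l in [set l : C^o | rnorm (l - 0) <= 1]].

Lemma disc_line_compact x : compact (disc_line x).
Proof.
apply: continuous_compact (@compact_disc R 0 1).
by apply: continuous_subspaceT => l; exact: scalel_continuous.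
Qed.

Lemma disc_line_id x : disc_line x x.
Proof.
exists 1; last exact: scale1r.
by rewrite /= subr0 /rnorm normr1.
Qed.

Lemma disc_line_balanced x : balanced (disc_line x).
Proof.
move=> a _ a1 [l l1 <-]; exists (a * l); last by rewrite scalerA.
have {}a1 : rnorm a <= 1 by rewrite -lecR rnormE.
move: l1; rewrite /= !subr0 rnormM => l1.
by rewrite mulr_ile1 ?rnorm_ge0.
Qed.

Lemma nachbin_seminorm_ge (x : E) n f :
  ((rnorm (taylor f 0 n x))%:E <= nachbin_seminorm (disc_line x) (fun=> 0%R)
    f)%E.
Proof.
pose u m := ereal_sup [set (rnorm (taylor f 0 m (k + (0 : C^o) *: b)))%:E
  | k in disc_line x & b in ball (0 : E) 1].
change ((rnorm (taylor f 0 n x))%:E <= \sum_(0 <= m <oo) u m)%E.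
have un m : ((rnorm (taylor f 0 m x))%:E <= u m)%E.
  apply: ereal_sup_ubound; exists x; first exact: disc_line_id.
  exists 0; first exact: ballxx.
  by rewrite scaler0 addr0.
have u0 m : (0 <= u m)%E by apply: le_trans (un m); rewrite lee_fin rnorm_ge0.
apply: le_trans (un n) _; apply: le_trans (nneseries_lim_ge n.+1 _) => //.
by rewrite big_nat_recr//= leeDr// sume_ge0.
Qed.

Lemma nachbin_seminorm_subr (x : E) f :
  nachbin_seminorm (disc_line x) (fun=> 0) ((f - f)%R : cholo E F) = 0%E.
Proof.
rewrite /nachbin_seminorm eseries0// => n _ _.
rewrite (_ : [set _ | _ in _ & _ in _] = [set 0%E]) ?ereal_sup1//.
apply/seteqP; split => [_ [k _ [b _ <-]]|_ ->] /=.
  by rewrite taylorB ?subrr ?rnorm0//; exact: cholo_holomorphic.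
exists x; first exact: disc_line_id.
exists 0; first exact: ballxx.
by rewrite taylorB ?subrr ?rnorm0//; exact: cholo_holomorphic.
Qed.

Lemma nbhs_nachbin_ball g x (r : R) : 0 < r ->
  nbhs g (nachbin_ball (NachbinIndex g (disc_line x) (fun=> 0) r)).
Proof.
move=> r0; set i := NachbinIndex _ _ _ _.
apply: open_nbhs_nbhs; split.
  exists [set nachbin_ball i]; last by rewrite bigcup_set1.
  move=> _ ->; apply: finI_from1; split => //=.
  - by exists x; exact: disc_line_id.
  - exact: disc_line_compact.
  - exact: disc_line_balanced.
  - exact: cvg_cst.
by rewrite /nachbin_ball /= nachbin_seminorm_subr lte_fin.
Qed.

(** A single [f] serves both evaluations, so that a relation between two Taylor values can pass to
    the closure. *)
Lemma closure_taylor (V : set (cholo E F)) g x y m n (e : R) : closure V g ->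
  0 < e -> exists f, [/\ V f,
    rnorm (taylor f 0 m x - taylor g 0 m x) < e &
    rnorm (taylor f 0 n y - taylor g 0 n y) < e].
Proof.
move=> Vg e0.
have [f [Vf [fx fy]]] := Vg _ (filterI (nbhs_nachbin_ball g x e0)
  (nbhs_nachbin_ball g y e0)).
have close z k : nachbin_ball (NachbinIndex g (disc_line z) (fun=> 0) e) f ->
    rnorm (taylor f 0 k z - taylor g 0 k z) < e.
  move=> fz; rewrite -lte_fin; apply: le_lt_trans fz.
  have := nachbin_seminorm_ge z k (f - g).
  by rewrite /= taylorB//; exact: cholo_holomorphic.
by exists f; split=> //; exact: close.
Qed.

End nachbin.

(** * The closed infinite-dimensional subspace *)

Section spaceability.
Context (R : realType) (p : R) (p1 : 1 <= p).
Local Notation C := R[i].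
Local Notation E := (ell (lexx (1 : R))).
Local Notation F := (ell p1).

Definition diagonal_space : set (cholo E F) :=
  [set f | exists c : nat -> C, class_diagonal f c].

Lemma diagonal_space_submod : submod_closed [in diagonal_space].
Proof.
split; first by rewrite inE; exists (fun=> 0) => x j; rewrite mul0r.
move=> a f g; rewrite !inE => -[c fc] [c' gc].
exists (fun k => a * c k + c' k) => x j.
by rewrite choloD choloZ ellD ellZ fc gc mulrDl mulrA.
Qed.

Lemma indicator_growth k j :
  rnorm ((class j == k)%:R : C) <= 1 * 1 ^+ degree j.
Proof. by rewrite rnorm_nat expr1n mulr1; case: eqP. Qed.

Lemma indicator_cholo k :
  diagonal p1 ((fun l => (l == k)%:R : C) \o class) degree \in @cholo_pred R E
    F.
Proof.
rewrite inE; split.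
  exact: (diagonal_holomorphic p1 ltr01 degree_oo (indicator_growth k)).
exact: (diagonal_locally_compact p1 ltr01 degree_gt0 degree_oo
  (indicator_growth k)).
Qed.

(** A rank argument: if [n] maps spanned the space, evaluating the indicator maps of [n.+1] classes
    at unit vectors representing these classes would factor the identity matrix of size [n.+1]
    through dimension [n]. *)
Lemma diagonal_space_infinite : ~ finite_dimensional diagonal_space.
Proof.
move=> [n [v hv]].
pose f k := Cholo (indicator_cholo k).
have fE k x j : f k x j = (class j == k)%:R * x j ^+ degree j.
  by rewrite /= (diagonalE p1 ltr01 degree_oo (indicator_growth k)).
have /(_ _)/cid-/all_sig[M hM] k : exists c : 'I_n -> C, f k = \sum_(i < n) c i
  *: v i.
  by apply: hv; exists (fun l => (l == k)%:R) => x j; rewrite fE.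
have /(_ _)/cid-/all_sig[jj hjj] := class_surj.
pose A : 'M[C]_(n.+1, n) := \matrix_(i, l) M i l.
pose W : 'M[C]_(n, n.+1) := \matrix_(l, i) v l (delta (lexx (1 : R)) 1 (jj i))
  (jj i).
suff /mulmx1_min : A *m W = 1%:M by rewrite ltnn.
apply/matrixP => i i'; rewrite !mxE.
have := fE i (delta (lexx (1 : R)) 1 (jj i')) (jj i').
rewrite deltaE eqxx mulr1n expr1n mulr1 hjj eq_sym hM cholo_sum ell_sum.
move=> <-; apply: eq_bigr => l _.
by rewrite !mxE choloZ ellZ.
Qed.

Lemma diagonal_space_sub : diagonal_space `<=`
  ([set f : cholo E F | pcompact_taylor p f] `\`
   [set f : cholo E F | locally_pcompact_image p f]) `|` [set 0].
Proof.
move=> f [c fc]; have [ck|c0] := pselect (exists k, c k != 0); [left|right].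
  split; first exact: class_diagonal_pcompact (cholo_holomorphic f) fc.
  by have [k ck0] := ck; exact: class_diagonal_not_pcompact fc ck0.
apply/val_inj/funext => x; apply: ell_ext => j; rewrite /= fc.
have -> : c (class j) = 0 by apply: contrapT => /eqP ?; apply: c0;
  exists (class j).
by rewrite mul0r.
Qed.

(** For a diagonal map, the value at the [j']-th unit vector in degree [degree j'] recovers the
    coefficient of the class, so the identity links two Taylor values and survives approximation. *)
Lemma closure_diagonal_taylor (g : cholo E F) n x j j' :
  closure diagonal_space g -> class j' = class j ->
  taylor g 0 n x j =
  (taylor g 0 (degree j') (delta (lexx (1 : R)) 1 j') j' * x j ^+ n)
    *+ (degree j == n).
Proof.
move=> Vg jj'; set t := taylor g 0 _ _ j'.
apply/eqP; rewrite -subr_eq0; apply/eqP/rnorm0_eq0/eqP.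
rewrite eq_le rnorm_ge0 andbT; apply/ler_addgt0Pr => e e0; rewrite add0r.
pose s := rnorm (x j) ^+ n.
have s0 : 0 <= s by rewrite exprn_ge0// rnorm_ge0.
(* Two errors occur: one at [x] itself, and one in the coefficient, amplified by [s]. *)
have d0 : 0 < e / (1 + s) by rewrite divr_gt0//; lra.
have [f [[c fc] h1 h2]] :=
  closure_taylor x (delta (lexx (1 : R)) 1 j') n (degree j') Vg d0.
have hf := cholo_holomorphic f.
have {}h1 := le_lt_trans (rnorm_coord_le _ j) h1.
have {}h2 := le_lt_trans (rnorm_coord_le _ j') h2.
move: h1 h2; rewrite !ellB !(class_diagonal_taylor0 _ _ _ hf fc).
rewrite deltaE !eqxx !mulr1n expr1n mulr1 jj' -/t.
move: (taylor g 0 n x j) (c (class j)) => u b h1 h2.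
have -> : e = e / (1 + s) + e / (1 + s) * s.
  by rewrite -[X in X + _]mulr1 -mulrDr divfK// gt_eqF//; lra.
have -> : u - (t * x j ^+ n) *+ (degree j == n) =
    - ((b * x j ^+ n) *+ (degree j == n) - u) +
    ((b - t) * x j ^+ n) *+ (degree j == n).
  by rewrite mulrBl mulrnBl; ring.
apply: le_trans (ler_rnormD _ _) _; rewrite rnormN lerD ?(ltW h1)//.
case: eqP => _; last by rewrite mulr0n rnorm0 mulr_ge0// ltW.
by rewrite mulr1n rnormM rnormX ler_wpM2r// ltW.
Qed.

(** The coefficients of a limit [g] are read off at one representative per class. Its Taylor series
    at 0 then sums to the diagonal formula near 0; the resulting growth bound makes the diagonal map
    holomorphic everywhere, and the identity theorem equates the two. *)
Lemma diagonal_space_closed : closed diagonal_space.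
Proof.
move=> g Vg; have hg := cholo_holomorphic g.
have /(_ _)/cid-/all_sig[jj hjj] := class_surj.
pose c k := taylor g 0 (degree (jj k)) (delta (lexx (1 : R)) 1 (jj k)) (jj k).
have tE n x j : taylor g 0 n x j = (c (class j) * x j ^+ n) *+ (degree j == n).
  by apply: closure_diagonal_taylor => //; exact: hjj.
have [r r0 hr] := is_taylor_cvg (taylorP 0 hg).
have gE x : rnorm x < r -> forall j, g x j = c (class j) * x j ^+ degree j.
  move=> xr j; apply/eqP; rewrite -subr_eq0; apply/eqP/rnorm0_eq0/eqP.
  rewrite eq_le rnorm_ge0 andbT; apply/ler_addgt0Pr => e e0; rewrite add0r.
  (* Taking [N] above [degree j] makes the partial sum contain the only nonzero term of the [j]-th
     coordinate. *)
  have [N0 hN] := hr e e0; pose N := (N0 + (degree j).+1)%N.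
  have := hN N x (leq_addr _ _); rewrite subr0 => /(_ xr) /ltW.
  apply: le_trans; apply: le_trans (rnorm_coord_le _ j).
  rewrite ellB ell_sum (eq_bigr _ (fun (n : 'I_N) _ => tE n x j)).
  have jN : (degree j < N)%N by rewrite leq_addl.
  rewrite (bigD1 (Ordinal jN)) //= eqxx mulr1n big1 ?addr0// => n nj.
  by rewrite [_ == _]eq_sym (_ : (n == degree j :> nat) = false) ?mulr0n//;
    apply/negbTE.
have [A [B [B0 cAB]]] := class_coef_growth hg r0 gE.
exists c => x j.
pose D : E -> F := diagonal p1 (c \o class) degree.
have DE y i : D y i = c (class i) * y i ^+ degree i.
  exact: (diagonalE p1 B0 degree_oo cAB).
have hD : holomorphic D := diagonal_holomorphic p1 B0 degree_oo cAB.
have := holomorphic_eq0 (holomorphicB hg hD) r0 _ x.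
move=> /(_ _)/eqP h; rewrite -DE; congr (ell_seq _ j).
apply/eqP; rewrite -subr_eq0; apply: h => y yr.
apply/eqP; rewrite subr_eq0; apply/eqP/ell_ext => i.
by rewrite gE// DE.
Qed.

End spaceability.

Theorem proposition4p8 (R : realType) (p : R) (p1 : 1 <= p) :
  spaceable
    ([set f : cholo (ell (lexx (1 : R))) (ell p1) | pcompact_taylor p f] `\`
     [set f : cholo (ell (lexx (1 : R))) (ell p1) | locally_pcompact_image p f]).
Proof.
exists (@diagonal_space R p p1); split.
- exact: diagonal_space_submod.
- exact: diagonal_space_closed.
- exact: diagonal_space_infinite.
- exact: diagonal_space_sub.
Qed.
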